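(* Let $a=(-1,1)^\top$ and $\Theta=\{\mu\in\mathbb{R}^2:a^\top\mu\ge0\}$. Let $\mu_0=(m,m)^\top\in\mathbb{R}^2$ and let $X_1,X_2,\ldots$ be i.i.d. random vectors in $\mathbb{R}^2$ with mean $\mu_0$ such that: (i) $\Sigma=\operatorname{Var}(X_i)$ is positive definite; (ii) $\mathbb{E}\|X_i-\mu_0\|^3<\infty$; (iii) for every fixed $M<\infty$, $$\mathbb{P}\big[\mu_0+n^{-1/2}\{h\in\mathbb{R}^2:\|h\|\le M\}\subset\operatorname{int}\operatorname{conv}(X_1,\ldots,X_n)\big]\to1\quad(n\to\infty).$$ Let $\Delta_n=\sqrt n(\bar X-\mu_0)$ with $\bar X=n^{-1}\sum_{i=1}^nX_i$, and let $K=\{h\in\mathbb{R}^2:a^\top h\ge0\}$. Then, as $n\to\infty$, $$\ell_{\Theta,n}(\mu_0)=\Delta_n^\top\Sigma^{-1}\Delta_n-\inf_{h\in K}(\Delta_n-h)^\top\Sigma^{-1}(\Delta_n-h)+o_p(1).$$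
   Context: For $\mu\in\mathbb{R}^2$ the normalized empirical likelihood based on $X_1,\ldots,X_n$ is $$L_n(\mu)=\sup\Big\{\prod_{i=1}^n(np_i):\ p_i\ge0,\ \sum_{i=1}^np_i=1,\ \sum_{i=1}^np_i(X_i-\mu)=0\Big\},$$ where the supremum over the empty set is $0$. Put $\ell_n(\mu)=-2\log L_n(\mu)$, with value $+\infty$ if $L_n(\mu)=0$. Let $\mathcal{D}_{\Theta,n}$ be the event $\{\sup_{\nu\in\Theta}L_n(\nu)>0\}$. For $\mu\in\Theta$, on $\mathcal{D}_{\Theta,n}$ the constrained empirical log-likelihood ratio is $$\ell_{\Theta,n}(\mu)=-2\log\frac{L_n(\mu)}{\sup_{\nu\in\Theta}L_n(\nu)}=\ell_n(\mu)-\inf_{\nu\in\Theta}\ell_n(\nu),$$ and by convention $\ell_{\Theta,n}(\mu)=0$ on the complement of $\mathcal{D}_{\Theta,n}$. Here $\operatorname{conv}$ is the convex hull, $\operatorname{int}$ the interior, and $o_p(1)$ denotes a term converging to $0$ in probability. *)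

(* Defs.v *)
From HB Require Import structures.
From mathcomp Require Import all_boot all_order all_algebra finmap.
From mathcomp Require Import all_classical all_reals all_analysis.

Set Implicit Arguments.
Unset Strict Implicit.
Unset Printing Implicit Defensive.
Import Order.TTheory GRing.Theory Num.Theory.
Import numFieldNormedType.Exports.
Local Open Scope classical_set_scope.
Local Open Scope ring_scope.

Section euclidean.
Context {R : realType} {k : nat}.
Implicit Types (x y h : 'cV[R]_k) (A : 'M[R]_k).

Definition dotv x y : R := (x^T *m y) 0 0.

Definition qform A h : R := (h^T *m A *m h) 0 0.

(* The library norm on matrices is the sup norm. *)
Definition enorm x : R := Num.sqrt (dotv x x).

Definition posdefmx A : Prop := A^T = A /\ forall h, h != 0 -> 0 < qform A h.

Definition convex_hull (S : set 'cV[R]_k) : set 'cV[R]_k :=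
  smallest (fun C : set (convex_lmodType 'cV[R]_k) => convex_set C) S.

Definition borel : set (set 'cV[R]_k) := <<s [set U | open U] >>.

End euclidean.
Arguments borel : clear implicits.

Section probability.
Context {d : measure_display} {T : measurableType d} {R : realType}.
Variable P : probability T R.
Implicit Type k : nat.

Definition random_vector k (X : T -> 'cV[R]_k) : Prop :=
  forall B, borel R k B -> measurable (X @^-1` B).

Definition mutually_independent k (X : nat -> T -> 'cV[R]_k) : Prop :=
  forall (J : {fset nat}) (B : nat -> set 'cV[R]_k),
    (forall i, i \in J -> borel R k (B i)) ->
    P (\bigcap_(i in [set` J]) X i @^-1` B i) =
    (\prod_(i <- J) P (X i @^-1` B i))%E.

Definition identically_distributed k (X : nat -> T -> 'cV[R]_k) : Prop :=
  forall i j B, borel R k B -> P (X i @^-1` B) = P (X j @^-1` B).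

Definition iid_random_vectors k (X : nat -> T -> 'cV[R]_k) : Prop :=
  [/\ forall i, random_vector (X i), mutually_independent X
    & identically_distributed X].

Definition has_mean k (X : T -> 'cV[R]_k) (mu : 'cV[R]_k) : Prop :=
  forall a, 'E_P[fun w => (X w a 0)%R]%E = (mu a 0)%:E.

Definition has_variance k (X : T -> 'cV[R]_k) (Sigma : 'M[R]_k) : Prop :=
  forall a b,
    covariance P (fun w => X w a 0) (fun w => X w b 0) = (Sigma a b)%:E.

Definition is_op1 (Z : nat -> T -> \bar R) : Prop :=
  forall e : R, 0 < e ->
    P [set w | (e%:E < `|Z n w|)%E] @[n --> \oo] --> 0%E.

End probability.

Section empirical_likelihood.
Context {R : realType} {k n : nat}.
Implicit Types (x : 'I_n -> 'cV[R]_k) (mu : 'cV[R]_k) (Theta : set 'cV[R]_k).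

Definition EL_values x mu : set R :=
  [set r | exists p : 'I_n -> R,
    [/\ forall i, 0 <= p i, \sum_(i < n) p i = 1,
        \sum_(i < n) p i *: (x i - mu) = 0
      & r = \prod_(i < n) (n%:R * p i)]].

(* The library's [sup] sends the empty set to 0, as required here; by AM-GM
   the values are bounded by 1, so nonempty sets have their true supremum. *)
Definition EL x mu : R := sup (EL_values x mu).

Definition EL_sup x Theta : R := sup (EL x @` Theta).

(* [lne 0 = -oo], so [m2log 0 = +oo]. *)
Definition m2log (r : R) : \bar R := ((- 2 : R)%R%:E * lne r%:E)%E.

Definition constrained_ELR x Theta mu : \bar R :=
  if 0 < EL_sup x Theta then m2log (EL x mu / EL_sup x Theta) else 0%E.

End empirical_likelihood.

Section sample.
Context {R : realType} {k : nat}.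

(* The sample X_1, ..., X_n is X 0, ..., X n.-1 *)
Definition sample_mean (X : nat -> 'cV[R]_k) (n : nat) : 'cV[R]_k :=
  n%:R^-1 *: \sum_(i < n) X i.

Definition Delta (X : nat -> 'cV[R]_k) (mu : 'cV[R]_k) (n : nat) : 'cV[R]_k :=
  Num.sqrt n%:R *: (sample_mean X n - mu).

End sample.

Definition a_vec (R : realType) : 'cV[R]_2 :=
  \col_(i < 2) if i == 0 then -1 else 1.

(* Main.v *)
(* Because every weighted mean of the sample lying in [Theta] is an admissible
   mean, the supremum of the likelihood over [Theta] is a one-dimensional
   empirical likelihood for the projections [a . (X_i - mu0)], under the
   constraint that their weighted mean be nonnegative; it is 1 when
   [a . (Xbar - mu0) >= 0].  Both likelihoods are bracketed deterministically.
   With [y_i = X_i - mu0], mean [ybar] and [Q = n ybar^T S^-1 ybar]: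
   - above: for [t_i = (S^-1 ybar) . y_i] every admissible [p] satisfies
     [prod (n p_i) <= exp (- sum ln (1 + t_i))], by [x <= exp (x - 1)];
   - below: [p_i = (1 - b . (y_i - ybar)) / n] with [V b = n ybar], [V] the
     centered scatter matrix, is admissible once its entries are nonnegative.
   Expanding the logarithm to second order gives [-2 ln L = Q + o(1)] as soon as
   [max |y_i| = o(sqrt n)], [sqrt n ybar] is bounded and the empirical second
   moments converge; Markov's inequality for third moments, Chebyshev's
   inequality and the weak law of large numbers provide this. *)

Require Import Defs.
From HB Require Import structures.
From mathcomp Require Import all_boot all_order all_algebra finmap.
From mathcomp Require Import all_classical all_reals all_analysis.
From mathcomp Require Import measurable_realfun ring lra.

Set Implicit Arguments.
Unset Strict Implicit.
Unset Printing Implicit Defensive.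
Import Order.TTheory GRing.Theory Num.Theory.
Import numFieldNormedType.Exports.
Local Open Scope classical_set_scope.
Local Open Scope ring_scope.

(** * Quadratic forms *)

Section quadratic_form.
Context {R : realType} {k : nat}.
Implicit Types (x y h : 'cV[R]_k) (S : 'M[R]_k).

Lemma dotvE x y : dotv x y = \sum_i x i 0 * y i 0.
Proof. by rewrite /dotv mxE; apply: eq_bigr => i _; rewrite mxE. Qed.

Lemma dotvC x y : dotv x y = dotv y x.
Proof. by rewrite !dotvE; apply: eq_bigr => i _; rewrite mulrC. Qed.

Lemma dotvDr x y z : dotv x (y + z) = dotv x y + dotv x z.
Proof. by rewrite /dotv mulmxDr mxE. Qed.

Lemma dotvZr x c y : dotv x (c *: y) = c * dotv x y.
Proof. by rewrite /dotv -scalemxAr mxE. Qed.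

Lemma dotvDl x y z : dotv (x + y) z = dotv x z + dotv y z.
Proof. by rewrite dotvC dotvDr !(dotvC z). Qed.

Lemma dotvZl c x y : dotv (c *: x) y = c * dotv x y.
Proof. by rewrite dotvC dotvZr dotvC. Qed.

Lemma dotvBr x y z : dotv x (y - z) = dotv x y - dotv x z.
Proof. by rewrite -scaleN1r dotvDr dotvZr mulN1r. Qed.

Lemma dotv0r x : dotv x 0 = 0.
Proof. by rewrite -(scale0r 0) dotvZr mul0r. Qed.

Lemma dotv_sumr x (I : finType) (F : I -> 'cV[R]_k) :
  dotv x (\sum_i F i) = \sum_i dotv x (F i).
Proof.
by apply: (big_morph (dotv x)) => [y z|]; [exact: dotvDr|exact: dotv0r].
Qed.

Lemma qformE S h : qform S h = dotv h (S *m h).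
Proof. by rewrite /qform /dotv mulmxA. Qed.

Lemma qform_entries S h : qform S h = \sum_i \sum_j S i j * (h i 0 * h j 0).
Proof.
rewrite qformE dotvE; apply: eq_bigr => i _; rewrite mxE mulr_sumr.
by apply: eq_bigr => j _; ring.
Qed.

Lemma qformZ S c h : qform S (c *: h) = c ^+ 2 * qform S h.
Proof. by rewrite !qformE -scalemxAr dotvZr dotvZl; ring. Qed.

Lemma dotv_mulmxl S x y : S^T = S -> dotv (S *m x) y = dotv x (S *m y).
Proof. by move=> Ssym; rewrite /dotv trmx_mul Ssym mulmxA. Qed.

Lemma qformD S x y : S^T = S ->
  qform S (x + y) = qform S x + 2 * dotv x (S *m y) + qform S y.
Proof.
move=> Ssym; rewrite !qformE mulmxDr dotvDr !dotvDl.
rewrite -(dotv_mulmxl x y) // (dotvC (S *m x)); ring.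
Qed.

Lemma posdefmx_sym S : posdefmx S -> S^T = S. Proof. by case. Qed.

Lemma qform_ge0 S h : posdefmx S -> 0 <= qform S h.
Proof.
case=> _ Spos; have [->|/Spos/ltW//] := eqVneq h 0.
by rewrite qformE mulmx0 dotv0r.
Qed.

(** A vector in the left kernel would make the form vanish. Positivity alone is asked for, which is
    what gets established for the scatter matrix [V] of the sample. *)
Lemma posdefmx_unit S : (forall h, h != 0 -> 0 < qform S h) -> S \in unitmx.
Proof.
move=> Spos; rewrite -row_free_unit -kermx_eq0; apply/rowV0P => v.
move=> /sub_kermxP vS0; apply/eqP/negP => /negP vn0.
have : v^T != 0 by rewrite -(inj_eq (@trmx_inj _ _ _)) trmx0 trmxK.
by move=> /Spos; rewrite /qform trmxK vS0 mul0mx mxE ltxx.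
Qed.

(** Expand the form at [qform S y *: x - b *: y], with [b] the mixed term: its value is [qform S y]
    times the difference of the two sides. *)
Lemma cauchy_schwarz_qform S x y : posdefmx S ->
  dotv x (S *m y) ^+ 2 <= qform S x * qform S y.
Proof.
move=> Spd; have [->|yn0] := eqVneq y 0.
  by rewrite mulmx0 dotv0r expr0n mulr_ge0 // qform_ge0.
have qy : 0 < qform S y by case: Spd => _; apply.
set b := dotv _ _.
have : 0 <= qform S (qform S y *: x + (- b) *: y) by exact: qform_ge0.
rewrite qformD ?qformZ ?posdefmx_sym // -scalemxAr dotvZr dotvZl -/b.
have -> : qform S y ^+ 2 * qform S x + 2 * (- b * (qform S y * b)) +
  (- b) ^+ 2 * qform S y = qform S y * (qform S x * qform S y - b ^+ 2) by ring.
by rewrite pmulr_rge0 // subr_ge0.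
Qed.

Lemma invmx_sym S : S^T = S -> (invmx S)^T = invmx S.
Proof. by move=> Ssym; rewrite trmx_inv Ssym. Qed.

Lemma qform_invmx S y : posdefmx S ->
  qform (invmx S) y = qform S (invmx S *m y).
Proof.
move=> [Ssym /posdefmx_unit Su].
by rewrite !qformE mulKVmx // dotvC.
Qed.

Lemma qform_invmx_ge0 S y : posdefmx S -> 0 <= qform (invmx S) y.
Proof. by move=> Spd; rewrite qform_invmx // qform_ge0. Qed.

Lemma posdefmx_inv S : posdefmx S -> posdefmx (invmx S).
Proof.
move=> Spd; case: (Spd) => Ssym /[dup] Spos /posdefmx_unit Su.
split; first exact: invmx_sym.
move=> h hn0; rewrite qform_invmx //; apply: Spos.
by apply: contra_neq hn0 => /(congr1 (mulmx S)); rewrite mulmx0 mulKVmx.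
Qed.

(** Cauchy-Schwarz for [x] and [invmx S *m y]. This pairing of [S] with its inverse is the source of
    most bounds on tilts and projections below. *)
Lemma cauchy_schwarz_dual S x y : posdefmx S ->
  dotv x y ^+ 2 <= qform S x * qform (invmx S) y.
Proof.
move=> Spd; rewrite qform_invmx //.
have Su : S \in unitmx by apply: posdefmx_unit; case: Spd.
by have := cauchy_schwarz_qform x (invmx S *m y) Spd; rewrite mulKVmx.
Qed.

(** The parallelogram law with the term [qform S (x + y)] dropped. *)
Lemma qformB_le S x y : posdefmx S ->
  qform S (x - y) <= 2 * qform S x + 2 * qform S y.
Proof.
move=> Spd; have := qform_ge0 (x + y) Spd.
rewrite -(scaleN1r y) !qformD ?posdefmx_sym // -scalemxAr dotvZr qformZ; lra.
Qed.

End quadratic_form.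

(** * Second-order lower bound for the logarithm *)

Section log_bound.
Context {R : realType}.

(** The allowed cubic error exceeds the true Taylor term, which leaves room for a comparison of
    derivatives: that of [f c] is [t ^+ 2] times [(1 + t)^-1 - 3 * c], of constant sign on each side
    of 0 for a suitable [c]. *)
Lemma ln1Dx_ge (x : R) : `|x| <= 1 / 2 -> x - (1 / 2 + `|x|) * x ^+ 2 <= ln (1 + x).
Proof.
move=> x12.
pose f c (t : R) := ln (1 + t) - t + 2^-1 * t ^+ 2 - c * t ^+ 3.
have f0 c : f c 0 = 0 by rewrite /f addr0 ln1 !expr0n /=; ring.
have df c (t : R) : -1 < t -> is_derive t 1 (f c) (t ^+ 2 * ((1 + t)^-1 - 3 * c)).
  move=> t1; have t0 : 0 < 1 + t by lra.
  have dln : is_derive t 1 (@ln R \o (fun s : R => 1 + s)) (1 + t)^-1.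
    have dD : is_derive t 1 (fun s : R => 1 + s) (1 : R).
      have := is_deriveD (is_derive_cst (1 : R) t 1) (is_derive_id t 1).
      by rewrite add0r.
    have := @is_derive1_comp R (@ln R) (fun s : R => 1 + s) t (1 + t)^-1 1
      (is_derive1_ln t0) dD.
    by rewrite mulr1.
  have -> : f c = (@ln R \o (fun s : R => 1 + s)) - id + 2^-1 \*: (id ^+ 2)
      - c \*: (id ^+ 3).
    by [].
  apply: is_derive_eq.
  rewrite /GRing.scale /= !mulr1.
  rewrite expr1.
  by field; lra.
have cf c (a b : R) : -1 < a -> {within `[a, b], continuous (f c)}.
  move=> a1; apply: derivable_within_continuous => t.
  rewrite in_itv /= => /andP[at_ _].
  by have [] := df c t (lt_le_trans a1 at_).
(* Take [c = -1] for [x >= 0] and [c = 1] for [x < 0]: in both cases [c * x ^+ 3] is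
   [- |x| * x ^+ 2]. *)
have [x0|x0] := leP 0 x.
  have : f (-1) 0 <= f (-1) x.
    apply: (@ger0_derive1_ndecr R (f (-1)) 0 x) => //; last by apply: cf; lra.
    - move=> t; rewrite in_itv /= => /andP[t0 _].
      by have [] := df (-1) t ltac:(lra).
    - move=> t; rewrite in_itv /= => /andP[t0 _].
      have := df (-1) t ltac:(lra) => dft; rewrite derive1E derive_val.
      by rewrite mulr_ge0 ?sqr_ge0 // addr_ge0 ?invr_ge0; lra.
  rewrite f0 /f ger0_norm //; have := sqr_ge0 x; rewrite (exprS _ 2); nra.
have : f 1 x >= f 1 0.
  rewrite ltr0_norm // in x12.
  apply: (@ler0_derive1_nincr R (f 1) x 0) => //; try lra; last by apply: cf; lra.
  - move=> t; rewrite in_itv /= => /andP[t0 _].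
    by have [] := df 1 t ltac:(lra).
  - move=> t; rewrite in_itv /= => /andP[xt _].
    have := df 1 t ltac:(lra) => dft; rewrite derive1E derive_val.
    rewrite mulr_ge0_le0 ?sqr_ge0 // subr_le0 -(@invrK _ 3) mulr1.
    by rewrite lef_pV2 ?posrE; lra.
rewrite f0 /f ltr0_norm // (exprS _ 2); lra.
Qed.

End log_bound.

(** * Bounds on the empirical likelihood *)

Section product_bounds.
Context {R : realType} {n : nat}.
Implicit Types p t u : 'I_n -> R.

(** Since [sum p_i (1 + t_i) <= 1], bounding each [n p_i (1 + t_i)] by the exponential of itself
    minus 1 shows that their product is at most 1. Dividing by [prod (1 + t_i)] leaves the
    logarithms. *)
Lemma prod_weights_le p t (c : R) :
  (forall i, 0 <= p i) -> \sum_i p i = 1 -> \sum_i p i * t i <= 0 ->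
  c <= 1 / 2 -> (forall i, `|t i| <= c) ->
  \prod_i (n%:R * p i) <=
    expR (- (\sum_i t i - (1 / 2 + c) * \sum_i t i ^+ 2)).
Proof.
move=> p0 p1 pt c12 tc.
pose e i := n%:R * (p i * (1 + t i)) - 1 - (t i - (1 / 2 + c) * t i ^+ 2).
apply: (@le_trans _ _ (\prod_i expR (e i))).
  apply: ler_prod => i _; rewrite mulr_ge0 ?ler0n //=.
  have t1 : 0 < 1 + t i by have := tc i; rewrite ler_norml => /andP[]; lra.
  have lnt : t i - (1 / 2 + c) * t i ^+ 2 <= ln (1 + t i).
    apply: le_trans (ln1Dx_ge (le_trans (tc i) c12)).
    by rewrite lerD2l lerN2 ler_wpM2r ?sqr_ge0 // lerD2l.
  apply: (@le_trans _ _ (expR (n%:R * (p i * (1 + t i)) - 1 - ln (1 + t i)))).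
    rewrite expRB lnK ?posrE // ler_pdivlMr // -mulrA.
    by apply: le_trans (expR_ge1Dx _); lra.
  by rewrite ler_expR lerD2l lerN2.
rewrite -expR_sum ler_expR /e sumrB sumrB sumr_const card_ord -mulr_sumr.
rewrite sumrB -mulr_sumr.
under eq_bigr do rewrite mulrDr mulr1.
rewrite big_split /= p1 -[X in _ - X - _]/(n%:R).
have : n%:R * \sum_i p i * t i <= 0 by rewrite mulr_ge0_le0.
lra.
Qed.

(** AM-GM, as the case of zero tilts. *)
Lemma prod_weights_le1 p :
  (forall i, 0 <= p i) -> \sum_i p i = 1 -> \prod_i (n%:R * p i) <= 1.
Proof.
move=> p0 p1; have := @prod_weights_le p (fun=> 0) 0 p0 p1.
have -> : \sum_i p i * 0 = 0 by rewrite -mulr_suml mulr0.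
have -> : \sum_(i < n) (0 : R) = 0 by rewrite big1.
have -> : \sum_(i < n) (0 : R) ^+ 2 = 0 by rewrite big1 // => i _; rewrite expr0n.
rewrite mulr0 subrr oppr0 expR0.
by apply; rewrite ?normr0 //; lra.
Qed.

(** The linear terms of the logarithms cancel because the [u i] sum to 0. *)
Lemma prod1B_ge u (c : R) : \sum_i u i = 0 ->
  c <= 1 / 2 -> (forall i, `|u i| <= c) ->
  expR (- ((1 / 2 + c) * \sum_i u i ^+ 2)) <= \prod_i (1 - u i).
Proof.
move=> u0 c12 uc.
have -> : - ((1 / 2 + c) * \sum_i u i ^+ 2) =
    \sum_i (- u i - (1 / 2 + c) * (- u i) ^+ 2).
  rewrite sumrB sumrN u0 oppr0 sub0r mulr_sumr.
  by congr (- _); apply: eq_bigr => i _; rewrite sqrrN.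
rewrite expR_sum; apply: ler_prod => i _; rewrite expR_ge0 /=.
have u1 : 0 < 1 - u i by have := uc i; rewrite ler_norml => /andP[]; lra.
rewrite -[leRHS]lnK ?posrE // ler_expR.
have Nuc : `|- u i| <= c by rewrite normrN.
apply: le_trans (ln1Dx_ge (le_trans Nuc c12)).
by rewrite lerD2l lerN2 ler_wpM2r ?sqr_ge0 // lerD2l.
Qed.

End product_bounds.

(** * Likelihood products of a well-spread sample *)

Section likelihood_bounds.
Context {R : realType} {k n : nat}.
Implicit Types (y : 'I_n -> 'cV[R]_k) (S : 'M[R]_k) (M c : R).

Definition average y : 'cV[R]_k := n%:R^-1 *: \sum_i y i.

(** The deterministic conditions under which the expansion holds, with tolerance [c] and bound [M]:
    [n] is large, no single point dominates, the mean is of order [1 / sqrt n], and the second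
    moments are close to those of [S], relatively and in every direction. *)
Definition well_spread S y M c : Prop :=
  [/\ 4 * M <= c * n%:R,
      forall i, 16 * M * qform (invmx S) (y i) <= c ^+ 2 * n%:R,
      n%:R * qform (invmx S) (average y) <= M
    & forall h, `|\sum_i dotv h (y i) ^+ 2 - n%:R * qform S h| <=
        c / 2 * (n%:R * qform S h)].

(** Tilting by [t_i = l . y_i] makes [sum t_i = Q] and [sum t_i^2] close to [Q], so the exponent is
    about [- Q / 2]. The constraint enters through the sign of [sum p_i t_i], which serves a fixed
    mean as well as a half-space of means. *)
Lemma well_spread_prod_le S y M c (p : 'I_n -> R) : posdefmx S ->
  (0 < n)%N -> 0 < M -> 0 < c <= 1 / 4 -> well_spread S y M c ->
  (forall i, 0 <= p i) -> \sum_i p i = 1 ->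
  \sum_i p i * dotv (invmx S *m average y) (y i) <= 0 ->
  \prod_i (n%:R * p i) <=
    expR (- ((n%:R * qform (invmx S) (average y) - 6 * c * M) / 2)).
Proof.
move=> Spd n0 M0 /andP[c0 c14] [_ yb Qb Vb] p0 p1 pt.
have nR0 : 0 < n%:R :> R by rewrite ltr0n.
set l := invmx S *m average y in pt *.
set Q := n%:R * qform _ _ in Qb *.
have Q0 : 0 <= Q by rewrite mulr_ge0 ?ler0n // qform_invmx_ge0.
have ql : n%:R * qform S l = Q by rewrite /Q qform_invmx.
(* The dual bound gives [t_i^2 <= (Q / n) * qform (invmx S) (y i)], and the factor 16 in
   [well_spread] turns this into [(c / 4)^2]. *)
have tb i : `|dotv l (y i)| <= c / 4.
  rewrite -(@ler_pXn2r _ 2) ?nnegrE ?normr_ge0 //; last lra.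
  rewrite real_normK ?num_real //.
  apply: le_trans (cauchy_schwarz_dual _ _ Spd) _.
  have qi : 0 <= qform (invmx S) (y i) by exact: qform_invmx_ge0.
  have -> : qform S l = Q / n%:R by rewrite -ql mulrC mulKf ?gt_eqF.
  rewrite mulrAC ler_pdivrMr //.
  have := ler_wpM2r qi Qb; have := yb i; lra.
apply: le_trans (prod_weights_le p0 p1 pt _ tb) _; first lra.
rewrite ler_expR lerN2.
have -> : \sum_i dotv l (y i) = Q.
  have sumy : \sum_i y i = n%:R *: average y.
    by rewrite /average scalerA divff ?gt_eqF // scale1r.
  by rewrite -dotv_sumr sumy dotvZr /Q qformE dotvC.
have := Vb l; rewrite ql ler_norml => /andP[_ Vl].
(* The factor [1 / 2 + c / 4] comes from the size of the tilts, [1 + c / 2] from the second moments;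
   the excess over [Q / 2] is of order [c * Q] and is absorbed by [6 * c * M / 2]. *)
have : (1 / 2 + c / 4) * \sum_i dotv l (y i) ^+ 2 <= (1 / 2 + c / 4) * ((1 + c / 2) * Q).
  by rewrite ler_wpM2l; lra.
have : c * Q <= c * M by rewrite ler_wpM2l // ltW.
have : 0 <= c * Q by rewrite mulr_ge0 // ltW.
have : c * (c * Q) <= 1 / 4 * (c * Q) by rewrite ler_wpM2r // mulr_ge0 // ltW.
lra.
Qed.

(** The weights [(1 - u_i) / n] have mean [ybar - V b / n], which [V b = n ybar] makes 0. The work
    lies in [|u_i| <= c] and in bounding [sum u_i^2] by nearly [Q]. *)
Lemma well_spread_prod_ge S y M c : posdefmx S ->
  (0 < n)%N -> 0 < M -> 0 < c <= 1 / 4 -> well_spread S y M c ->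
  exists p : 'I_n -> R, [/\ forall i, 0 <= p i, \sum_i p i = 1,
    \sum_i p i *: y i = 0
  & expR (- ((n%:R * qform (invmx S) (average y) + 6 * c * M) / 2)) <=
     \prod_i (n%:R * p i)].
Proof.
move=> Spd n0 M0 /andP[c0 c14] [nb yb Qb Vb].
have nR0 : 0 < n%:R :> R by rewrite ltr0n.
set ybar := average y in Qb *.
set Q := n%:R * qform _ _ in Qb *.
have Q0 : 0 <= Q by rewrite mulr_ge0 ?ler0n // qform_invmx_ge0.
have sumy : \sum_i y i = n%:R *: ybar.
  by rewrite /ybar /average scalerA divff ?gt_eqF // scale1r.
pose V : 'M[R]_k := \sum_i (y i - ybar) *m (y i - ybar)^T.
have Vmul h : V *m h = \sum_i dotv h (y i - ybar) *: (y i - ybar).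
  rewrite /V mulmx_suml; apply: eq_bigr => i _.
  by rewrite -mulmxA [_^T *m h]mx11_scalar mul_mx_scalar dotvC.
have qV h : qform V h = \sum_i dotv h (y i - ybar) ^+ 2.
  by rewrite qformE Vmul dotv_sumr; apply: eq_bigr => i _; rewrite dotvZr expr2.
have sumh h : \sum_i dotv h (y i) = n%:R * dotv h ybar.
  by rewrite -dotv_sumr sumy dotvZr.
have sum0 h : \sum_i dotv h (y i - ybar) = 0.
  under eq_bigr do rewrite dotvBr.
  by rewrite sumrB sumh sumr_const card_ord mulr_natl subrr.
have qVE h : qform V h = \sum_i dotv h (y i) ^+ 2 - n%:R * dotv h ybar ^+ 2.
  rewrite qV; under eq_bigr do rewrite dotvBr sqrrB.
  rewrite big_split sumrB /= sumr_const card_ord sumrMnl -mulr_suml sumh.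
  by ring.
(* The second moments cost [c / 2], the subtraction of the mean another [c / 4] by [4 * M <= c * n];
   the total stays below [c]. *)
have qVge h : (1 - c) * (n%:R * qform S h) <= qform V h.
  rewrite qVE; have := Vb h; rewrite ler_norml => /andP[Vl _].
  have qh := qform_ge0 h Spd.
  have : n%:R * dotv h ybar ^+ 2 <= c / 4 * (n%:R * qform S h).
    apply: (@le_trans _ _ (qform S h * Q)).
      rewrite /Q [leRHS]mulrCA ler_pM2l //; exact: cauchy_schwarz_dual.
    have -> : c / 4 * (n%:R * qform S h) = qform S h * (c * n%:R / 4) by ring.
    by rewrite ler_wpM2l //; lra.
  have : 0 <= c * (n%:R * qform S h).
    by rewrite mulr_ge0 ?(ltW c0) // mulr_ge0 // ltW.
  lra.
have Vu : V \in unitmx.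
  apply: posdefmx_unit => h hn0; apply: lt_le_trans (qVge h).
  have : 0 < qform S h by case: Spd => _; exact.
  by move=> qh; rewrite mulr_gt0 ?mulr_gt0 //; lra.
pose b := n%:R *: (invmx V *m ybar).
have Vb' : V *m b = n%:R *: ybar by rewrite /b -scalemxAr mulKVmx.
pose u i := dotv b (y i - ybar).
have u2 : \sum_i u i ^+ 2 = n%:R * dotv b ybar.
  by rewrite -qV qformE Vb' dotvZr.
set W := \sum_i u i ^+ 2 in u2.
have W0 : 0 <= W by apply: sumr_ge0 => i _; exact: sqr_ge0.
have qSb : (1 - c) * (n%:R * qform S b) <= W by rewrite /W -qV; exact: qVge.
have qSb0 := qform_ge0 b Spd.
(* As [W = n b . ybar], the dual bound yields [W^2 <= (n * qform S b) * Q]; with [qSb] one factor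
   [W] cancels. *)
have WQ : (1 - c) * W <= Q.
  have [->|Wn0] := eqVneq W 0; first by rewrite mulr0.
  have Wgt0 : 0 < W by rewrite lt_def Wn0.
  rewrite -(ler_pM2r Wgt0) -mulrA -expr2 u2 exprMn.
  have := cauchy_schwarz_dual b ybar Spd.
  move=> /(ler_wpM2l (ltW nR0)) /(ler_wpM2l (ltW nR0)) cs.
  have c1 : 0 <= 1 - c by lra.
  have := ler_wpM2l c1 cs; rewrite -u2.
  have := ler_wpM2l Q0 qSb.
  rewrite /Q; lra.
(* Together [qSb] and [WQ] give [(1 - c)^2 * (n * qform S b) <= Q], and [(1 - c)^2 >= 9 / 16] since
   [c <= 1 / 4]. *)
have qbb : n%:R * qform S b <= 2 * Q.
  have : (1 - c) * (n%:R * qform S b) * (1 - c) <= Q.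
    by apply: le_trans WQ; rewrite mulrC ler_wpM2l //; lra.
  have : 0 <= n%:R * qform S b by rewrite mulr_ge0 // ltW.
  nra.
(* Each of [y i] and [ybar] contributes at most [c^2 n / 4] to the bound on [n u_i^2]; for [ybar]
   this again uses [4 * M <= c * n]. *)
have ub i : `|u i| <= c.
  rewrite -(@ler_pXn2r _ 2) ?nnegrE ?normr_ge0 //; last lra.
  rewrite real_normK ?num_real //.
  apply: le_trans (cauchy_schwarz_dual _ _ Spd) _.
  have qi : 0 <= qform (invmx S) (y i - ybar) by exact: qform_invmx_ge0.
  rewrite -(ler_pM2l nR0) mulrA.
  apply: (@le_trans _ _ (2 * Q * qform (invmx S) (y i - ybar))).
    by rewrite ler_wpM2r.
  apply: (@le_trans _ _ (2 * M * qform (invmx S) (y i - ybar))).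
    by rewrite ler_wpM2r // ler_wpM2l.
  have := qformB_le (y i) ybar (posdefmx_inv Spd) => qB.
  have M2 : 0 <= 2 * M by lra.
  apply: le_trans (ler_wpM2l M2 qB) _.
  have := yb i.
  have M4 : 0 <= 4 * M by lra.
  have MQ : 4 * M * (n%:R * qform (invmx S) ybar) <= 4 * M * M by rewrite ler_wpM2l.
  have cn : (4 * M) * (4 * M) <= (c * n%:R) * (c * n%:R) by rewrite ler_pM.
  have q4 : 4 * M * qform (invmx S) ybar <= c ^+ 2 * n%:R / 4.
    by rewrite -(ler_pM2l nR0); lra.
  have : 0 <= c ^+ 2 * n%:R by rewrite mulr_ge0 ?sqr_ge0.
  lra.
pose p i := n%:R^-1 * (1 - u i).
have np i : n%:R * p i = 1 - u i by rewrite /p mulrA divff ?mul1r // gt_eqF.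
exists p; split.
- move=> i; rewrite mulr_ge0 ?invr_ge0 ?ler0n //.
  by have := ub i; rewrite ler_norml => /andP[]; lra.
- by rewrite -mulr_sumr sumrB sumr_const card_ord sum0 subr0 mulVf // gt_eqF.
- rewrite /p; under eq_bigr do rewrite -scalerA scalerBl scale1r.
  rewrite -scaler_sumr sumrB sumy.
  have : \sum_i u i *: (y i - ybar) = n%:R *: ybar by rewrite -Vmul.
  under eq_bigr do rewrite scalerBr.
  rewrite sumrB -scaler_suml sum0 scale0r subr0 => ->.
  by rewrite subrr scaler0.
- under eq_bigr do rewrite np.
  apply: le_trans (prod1B_ge (sum0 b) _ ub); last lra.
  rewrite ler_expR lerN2 -/W.
  have : c * Q <= c * M by rewrite ler_wpM2l // ltW.
  have : 0 <= c * W by rewrite mulr_ge0 // ltW.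
  have : c * (c * W) <= 1 / 4 * (c * W) by rewrite ler_wpM2r // mulr_ge0 // ltW.
  have := ler_wpM2l (ltW c0) WQ.
  lra.
Qed.

End likelihood_bounds.

(** * Linear images of a well-spread sample *)

Section linear_image.
Context {R : realType} {k l n : nat}.
Variables (S : 'M[R]_k) (A : 'M[R]_(k, l)).
Hypotheses (Spd : posdefmx S) (SApd : posdefmx (A^T *m S *m A)).

Lemma dotv_trmulmx (h : 'cV[R]_l) (y : 'cV[R]_k) :
  dotv h (A^T *m y) = dotv (A *m h) y.
Proof. by rewrite /dotv trmx_mul mulmxA. Qed.

Lemma qform_trmulmx (h : 'cV[R]_l) : qform (A^T *m S *m A) h = qform S (A *m h).
Proof. by rewrite /qform trmx_mul !mulmxA. Qed.

(** For the [h] of the proof the left side equals both [(A h) . y] and [qform S (A h)], so by the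
    dual bound its square is at most itself times the right side. *)
Lemma qform_invmx_trmulmx (y : 'cV[R]_k) :
  qform (invmx (A^T *m S *m A)) (A^T *m y) <= qform (invmx S) y.
Proof.
have := SApd; set SA := _ *m A => SApd'; set h := invmx SA *m (A^T *m y).
have SAu : SA \in unitmx by apply: posdefmx_unit; case: SApd'.
have qh : qform (invmx SA) (A^T *m y) = dotv (A *m h) y.
  by rewrite -dotv_trmulmx qformE dotvC.
have qhS : qform (invmx SA) (A^T *m y) = qform S (A *m h).
  by rewrite qform_invmx // -qform_trmulmx.
have := qform_invmx_ge0 (A^T *m y) SApd'; rewrite le_eqVlt => /predU1P[<-|q0].
  exact: qform_invmx_ge0.
by rewrite -(ler_pM2l q0) -expr2 {1}qh qhS; exact: cauchy_schwarz_dual.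
Qed.

Lemma average_mulmx (y : 'I_n -> 'cV[R]_k) :
  average (fun i => A^T *m y i) = A^T *m average y.
Proof. by rewrite /average -scalemxAr mulmx_sumr. Qed.

(** Used with [A] the single column [a], which makes the half-space problem one-dimensional with the
    same [M] and [c]. *)
Lemma well_spread_mulmx (y : 'I_n -> 'cV[R]_k) M c : 0 < M ->
  well_spread S y M c ->
  well_spread (A^T *m S *m A) (fun i => A^T *m y i) M c.
Proof.
move=> M0 [nb yb Qb Vb]; split=> //.
- move=> i; apply: le_trans (yb i).
  by rewrite ler_wpM2l ?qform_invmx_trmulmx //; lra.
- by apply: le_trans Qb; rewrite average_mulmx ler_wpM2l ?qform_invmx_trmulmx.
- move=> h; under eq_bigr do rewrite dotv_trmulmx.
  by rewrite qform_trmulmx.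
Qed.

End linear_image.

(** * The empirical likelihood and its supremum over a set *)

Section empirical_likelihood_bounds.
Context {R : realType} {k n : nat}.
Variable x : 'I_n -> 'cV[R]_k.
Implicit Types (mu : 'cV[R]_k) (p : 'I_n -> R) (Theta : set 'cV[R]_k).

(** Where no supremum exists, [sup] has the default value 0. *)
Lemma sup_ge0 (E : set R) : (forall r, E r -> 0 <= r) -> 0 <= sup E.
Proof.
move=> E0; have [[[r Er] ubE]|/sup_out->//] := pselect (has_sup E).
by apply: le_trans (E0 _ Er) _; exact: ub_le_sup.
Qed.

Lemma EL_ge0 mu : 0 <= EL x mu.
Proof.
apply: sup_ge0 => _ [p [p0 _ _ ->]].
by apply: prodr_ge0 => i _; rewrite mulr_ge0.
Qed.

(** [0 <= B] covers the case of no admissible weights, where the likelihood is 0. *)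
Lemma EL_le mu B : 0 <= B ->
  (forall p, (forall i, 0 <= p i) -> \sum_i p i = 1 ->
     \sum_i p i *: (x i - mu) = 0 -> \prod_i (n%:R * p i) <= B) ->
  EL x mu <= B.
Proof.
move=> B0 pB; rewrite /EL; have [->|/set0P v0] := eqVneq (EL_values x mu) set0.
  by rewrite sup0.
by apply: ge_sup => // _ [p [p0 p1 pmu ->]]; exact: pB.
Qed.

Lemma has_ubound_EL_values mu : has_ubound (EL_values x mu).
Proof. by exists 1 => _ [p [p0 p1 _ ->]]; exact: prod_weights_le1. Qed.

Lemma EL_ge mu p : (forall i, 0 <= p i) -> \sum_i p i = 1 ->
  \sum_i p i *: (x i - mu) = 0 -> \prod_i (n%:R * p i) <= EL x mu.
Proof.
move=> p0 p1 pmu; apply: ub_le_sup; first exact: has_ubound_EL_values.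
by exists p.
Qed.

Lemma EL_le1 mu : EL x mu <= 1.
Proof. by apply: EL_le => // p p0 p1 _; exact: prod_weights_le1. Qed.

Lemma weighted_centered p mu : \sum_i p i = 1 ->
  \sum_i p i *: (x i - mu) = \sum_i p i *: x i - mu.
Proof.
move=> p1; under eq_bigr do rewrite scalerBr.
by rewrite sumrB -scaler_suml p1 scale1r.
Qed.

Lemma has_ubound_EL Theta : has_ubound (EL x @` Theta).
Proof. by exists 1 => _ [mu _ <-]; exact: EL_le1. Qed.

(** The nested suprema become one over weights, because the weights determine the mean for which
    they are admissible as [sum p_i x_i]. *)
Lemma EL_sup_le Theta B : 0 <= B ->
  (forall p, (forall i, 0 <= p i) -> \sum_i p i = 1 ->
     Theta (\sum_i p i *: x i) -> \prod_i (n%:R * p i) <= B) ->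
  EL_sup x Theta <= B.
Proof.
move=> B0 pB; have [->|/set0P T0] := eqVneq Theta set0.
  by rewrite /EL_sup image_set0 sup0.
apply: ge_sup => [|_ [mu Tmu <-]]; first exact: image_nonempty.
apply: EL_le => // p p0 p1; rewrite weighted_centered // => /subr0_eq pmu.
by apply: pB => //; rewrite pmu.
Qed.

Lemma EL_sup_ge Theta p : (forall i, 0 <= p i) -> \sum_i p i = 1 ->
  Theta (\sum_i p i *: x i) -> \prod_i (n%:R * p i) <= EL_sup x Theta.
Proof.
move=> p0 p1 Tp; apply: (@le_trans _ _ (EL x (\sum_i p i *: x i))).
  by apply: EL_ge => //; rewrite weighted_centered // subrr.
by apply: ub_le_sup; [exact: has_ubound_EL|exists (\sum_i p i *: x i)].
Qed.

Lemma EL_sup_ge0 Theta : 0 <= EL_sup x Theta.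
Proof. by apply: sup_ge0 => _ [mu _ <-]; exact: EL_ge0. Qed.

End empirical_likelihood_bounds.

(** * Distance to a half-space and projection onto its normal *)

Section half_space.
Context {R : realType} {k : nat}.
Variables (S : 'M[R]_k) (a : 'cV[R]_k).
Hypotheses (Spd : posdefmx S) (a0 : a != 0).

Let s := qform S a.

Let s_gt0 : 0 < s. Proof. by case: Spd => _; apply. Qed.

(** The dual bound in the direction [a] bounds the squared distance from below, and the projection
    of [y] in the metric of [invmx S] attains it. *)
Lemma inf_qform_half_space (y : 'cV[R]_k) :
  inf [set qform (invmx S) (y - h) | h in [set h | 0 <= dotv a h]] =
  Num.min 0 (dotv a y) ^+ 2 / s.
Proof.
set d := Num.min _ _; set E := image _ _.
have Su : S \in unitmx by apply: posdefmx_unit; case: Spd.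
have lbE : lbound E (d ^+ 2 / s).
  move=> _ [h /= ah <-]; rewrite ler_pdivrMr // mulrC.
  apply: le_trans (cauchy_schwarz_dual _ _ Spd).
  rewrite dotvBr /d; have [_|ay0] := leP 0 (dotv a y).
    by rewrite expr0n sqr_ge0.
  (* Here [a . (y - h) <= a . y < 0], so both sides are negated before squares are compared. *)
  by rewrite -sqrrN -[leRHS]sqrrN ler_pXn2r // ?nnegrE; lra.
have Ed : E (d ^+ 2 / s).
  (* [S a] is the normal direction in the metric of [invmx S]; for [y] in the half-space [d = 0] and
     the minimizer is [y] itself. *)
  exists (y - (d / s) *: (S *m a)) => /=.
    rewrite dotvBr dotvZr -qformE -/s mulfVK ?gt_eqF // subr_ge0.
    by rewrite /d ge_min lexx orbT.
  rewrite opprB addrC subrK qformZ qform_invmx // mulKmx // -/s.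
  by field; rewrite gt_eqF.
apply/eqP; rewrite eq_le; apply/andP; split.
  by apply: ge_inf => //; exists (d ^+ 2 / s).
by apply: lb_le_inf => //; exists (d ^+ 2 / s).
Qed.

Lemma dot_mulmx1 : a^T *m S *m a = s%:M.
Proof. by rewrite [LHS]mx11_scalar. Qed.

Lemma trmulmx11 (y : 'cV[R]_k) : a^T *m y = (dotv a y)%:M.
Proof. by rewrite [LHS]mx11_scalar. Qed.

Lemma qform_scalar1 (c t : R) : qform (c%:M : 'M[R]_1) t%:M = c * t ^+ 2.
Proof. by rewrite qform_entries !big_ord1 !mxE /= !mulr1n. Qed.

Lemma posdefmx_scalar1 : posdefmx (a^T *m S *m a).
Proof.
rewrite dot_mulmx1; split; first exact: tr_scalar_mx.
move=> h h0; rewrite [h]mx11_scalar qform_scalar1 mulr_gt0 // exprn_even_gt0 //=.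
by apply: contra_neq h0 => h0; rewrite [h]mx11_scalar h0 raddf0.
Qed.

Lemma qform_invmx_scalar1 (y : 'cV[R]_k) :
  qform (invmx (a^T *m S *m a)) (a^T *m y) = dotv a y ^+ 2 / s.
Proof. by rewrite dot_mulmx1 invmx_scalar trmulmx11 qform_scalar1 mulrC. Qed.

End half_space.

(** * Deterministic expansion of the constrained ratio *)

Section constrained_ratio.
Context {R : realType} {k n : nat}.
Variables (S : 'M[R]_k) (a mu0 : 'cV[R]_k) (x : 'I_n -> 'cV[R]_k) (M c : R).
Hypotheses (Spd : posdefmx S) (a0 : a != 0) (amu0 : dotv a mu0 = 0).
Hypotheses (n0 : (0 < n)%N) (M0 : 0 < M) (c0 : 0 < c <= 1 / 4).

Let y i := x i - mu0.
Hypothesis wsy : well_spread S y M c.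

Let Theta : set 'cV[R]_k := [set mu | 0 <= dotv a mu].
Let s := qform S a.
Let nR0 : 0 < n%:R :> R. Proof. by rewrite ltr0n. Qed.

Lemma EL_bounds : let Q := n%:R * qform (invmx S) (average y) in
  expR (- ((Q + 6 * c * M) / 2)) <= EL x mu0 <= expR (- ((Q - 6 * c * M) / 2)).
Proof.
apply/andP; split.
  have [p [p0 p1 py pge]] := well_spread_prod_ge Spd n0 M0 c0 wsy.
  by apply: le_trans pge _; exact: EL_ge.
apply: EL_le => [|p p0 p1 py]; first exact: expR_ge0.
apply: (well_spread_prod_le Spd n0 M0 c0 wsy) => //.
under eq_bigr do rewrite -dotvZr.
by rewrite -dotv_sumr py dotv0r.
Qed.

Let dot_weighted (p : 'I_n -> R) : \sum_i p i = 1 ->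
  dotv a (\sum_i p i *: x i) = \sum_i p i * dotv a (y i).
Proof.
move=> p1; under [RHS]eq_bigr do rewrite -dotvZr.
by rewrite -dotv_sumr weighted_centered // dotvBr amu0 subr0.
Qed.

Lemma EL_sup_bounds :
  let Q := n%:R * (Num.min 0 (dotv a (average y)) ^+ 2 / s) in
  expR (- ((Q + 6 * c * M) / 2)) <= EL_sup x Theta <=
  expR (- ((Q - 6 * c * M) / 2)).
Proof.
have cM : 0 < c * M by case/andP: c0 => ? _; rewrite mulr_gt0.
have [ay0|ay0] := leP 0 (dotv a (average y)).
  (* The sample mean lies in [Theta], so the uniform weights are admissible and the supremum is
     1. *)
  rewrite expr0n mul0r mulr0 /= add0r sub0r; apply/andP; split.
    pose p (i : 'I_n) := n%:R^-1 : R.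
    have p1 : \sum_i p i = 1.
      by rewrite sumr_const card_ord -[LHS]mulr_natr mulVf // gt_eqF.
    apply: (@le_trans _ _ (\prod_i (n%:R * p i))).
      by rewrite big1 => [|i _]; rewrite ?divff ?gt_eqF // -[leRHS]expR0 ler_expR; lra.
    apply: EL_sup_ge => // [i|]; first by rewrite /p invr_ge0.
    rewrite /Theta /= dot_weighted // -mulr_sumr -dotv_sumr -dotvZr.
    exact: ay0.
  apply: (@le_trans _ _ 1); last by rewrite -[leLHS]expR0 ler_expR; lra.
  by apply: EL_sup_le => // p p0 p1 _; exact: prod_weights_le1.
(* The sample mean lies outside [Theta]: pass to the one-dimensional sample [a^T y_i], with [s] in
   the place of [S]. *)
have spd := posdefmx_scalar1 Spd a0.
have ws := well_spread_mulmx Spd spd M0 wsy.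
apply/andP; split.
  (* Weights with projected mean 0 put the weighted mean on the boundary of [Theta], which belongs
     to [Theta]. *)
  have [p [p0 p1 py]] := well_spread_prod_ge spd n0 M0 c0 ws.
  rewrite average_mulmx qform_invmx_scalar1 // => pge.
  apply: le_trans pge _; apply: EL_sup_ge => //.
  rewrite /Theta /= dot_weighted //.
  move/matrixP: py => /(_ 0 0); rewrite summxE mxE => py0.
  rewrite [leRHS](_ : _ = 0) // -[RHS]py0; apply: eq_bigr => i _.
  by rewrite [in RHS]mxE trmulmx11 !mxE mulr1n.
apply: EL_sup_le => [|p p0 p1]; first exact: expR_ge0.
rewrite /Theta /= dot_weighted // => pa.
have := well_spread_prod_le spd n0 M0 c0 ws p0 p1.
rewrite average_mulmx qform_invmx_scalar1 //; apply.
rewrite dot_mulmx1 invmx_scalar trmulmx11 -scalar_mxM.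
under eq_bigr => i _.
  rewrite trmulmx11 dotvE big_ord1 !mxE !mulr1n mulrCA; over.
(* The tilt is [(a . ybar / s) * (a . y_i)]; the first factor is negative and the weighted sum of
   the second is nonnegative. *)
rewrite -mulr_sumr mulr_le0_ge0 // mulr_ge0_le0 ?invr_ge0 ?ltW //.
by case: Spd => _; apply.
Qed.

(** Numerator and denominator each have [-2 ln] within [6 * c * M] of their quadratic term. Both are
    positive here, so the ratio has a finite logarithm. *)
Lemma constrained_ELR_approx (D : 'cV[R]_k) : D = Num.sqrt n%:R *: average y ->
  (`| constrained_ELR x Theta mu0 -
     (qform (invmx S) D - inf [set qform (invmx S) (D - h) | h in Theta])%:E |
     <= (12 * c * M)%:E)%E.
Proof.
move=> ->; rewrite inf_qform_half_space // qformZ sqr_sqrtr ?ler0n //.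
rewrite dotvZr.
have -> : Num.min 0 (Num.sqrt n%:R * dotv a (average y)) =
    Num.sqrt n%:R * Num.min 0 (dotv a (average y)).
  by rewrite minr_pMr ?sqrtr_ge0 // mulr0.
rewrite exprMn sqr_sqrtr ?ler0n // -[X in _ - X]mulrA.
have := EL_bounds; have := EL_sup_bounds => /=.
set Q1 := n%:R * (_ / _); set Q := n%:R * qform _ _.
set L1 := EL_sup _ _; set L := EL _ _.
move=> /andP[L1l L1u] /andP[Ll Lu].
have L10 : 0 < L1 by apply: lt_le_trans L1l; exact: expR_gt0.
have L0 : 0 < L by apply: lt_le_trans Ll; exact: expR_gt0.
rewrite /constrained_ELR -/L1 L10 -/L /m2log lne_EFin ?divr_gt0 //.
rewrite ln_div ?posrE // -EFinM -EFinB abse_EFin lee_fin.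
rewrite -[_ <= _]ler_ln ?posrE ?expR_gt0 // expRK in L1l.
rewrite -[_ <= _]ler_ln ?posrE ?expR_gt0 // expRK in L1u.
rewrite -[_ <= _]ler_ln ?posrE ?expR_gt0 // expRK in Ll.
rewrite -[_ <= _]ler_ln ?posrE ?expR_gt0 // expRK in Lu.
rewrite ler_norml; apply/andP; split; lra.
Qed.

End constrained_ratio.

(** * Measurability of the likelihood *)

Section compact_projection.
Context {d : measure_display} {T : measurableType d} {R : realType} {n : nat}.

(** The endpoint 1 is itself rational; any other [r] has rationals slightly to its right inside the
    interval. *)
Lemma rat_nbhs_itv01 (r : R) (U : set R) : 0 <= r <= 1 -> nbhs r U ->
  exists2 q : rat, 0 <= q <= 1 & U (ratr q).
Proof.
move=> /andP[r0 r1] /nbhs_ballP[e /= e0 rU].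
have [rE|rn1] := eqVneq r 1.
  by exists 1; rewrite ?ler01 // rmorph1 -rE; apply: rU; exact: ballxx.
have rlt1 : r < 1 by rewrite lt_neqAle rn1.
have /rat_in_itvoo[q] : r < Num.min 1 (r + e) by rewrite lt_min rlt1 ltrDl e0.
rewrite in_itv /= lt_min => /and3P[rq q1 qe]; exists q.
  apply/andP; split; rewrite -(ler_rat R) ?rmorph0 ?rmorph1 ?(ltW q1) //.
  by rewrite (le_trans r0) // ltW.
by apply: rU; rewrite /ball /= ltr0_norm ?subr_lt0 // opprB ltrBlDl.
Qed.

(** The uncountable union over [v] becomes countable: by compactness and continuity a nonpositive
    value exists exactly when rational points of the cube bring [h] below every [1 / (m + 1)]. *)
Lemma measurable_exists_cube (h : T -> 'rV[R]_n -> R) :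
  (forall v, measurable_fun setT (h^~ v)) -> (forall w, continuous (h w)) ->
  measurable [set w | exists2 v : 'rV[R]_n,
    (forall i, 0 <= v 0 i <= 1) & h w v <= 0].
Proof.
move=> mh ch; pose cube : set 'rV[R]_n := [set v | forall i, `[0, 1]%classic (v ord0 i)].
pose D : set 'rV[rat]_n := [set q | forall i, 0 <= q ord0 i <= 1].
rewrite (_ : [set w | _] = \bigcap_m \bigcup_(q : 'rV[rat]_n)
   (if `[< D q >] then [set w | h w (map_mx ratr q) < m.+1%:R^-1] else set0)); last first.
  apply/seteqP; split=> w /=.
    move=> [v v01 hv] m _.
    have /ch[/= P vP PU] : nbhs (h w v) [set r | r < m.+1%:R^-1].
      by apply: open_nbhs_nbhs; split; [exact: open_lt|exact: le_lt_trans hv _].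
    have /choice[q qP] i : exists q : rat, 0 <= q <= 1 /\ P ord0 i (ratr q).
      by have [q q01 Pq] := rat_nbhs_itv01 (v01 i) (vP 0 i); exists q.
    exists (\row_i q i) => //.
    have Dq : D (\row_i q i) by move=> i; rewrite mxE; case: (qP i).
    rewrite asboolT //; apply: PU => i j /=; rewrite !mxE ord1.
    by case: (qP j).
  move=> hw.
  have cube0 : cube !=set0.
    by exists 0 => i /=; rewrite mxE in_itv /= lexx ler01.
  have cubeC : compact cube.
    apply: (@rV_compact R n (fun=> `[(0 : R), 1]%classic)) => _.
    exact: segment_compact.
  have chw : {within cube, continuous (h w)}.
    by apply: (@continuous_subspaceT _ _ cube (h w)); exact: ch.
  (* A positive minimum would exceed some [1 / (m + 1)], against the rational point at that
     level. *)
  have [v + vmin] := compact_EVT_min cube0 cubeC chw.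
  rewrite inE => cv; exists v; first by move=> i; have := cv i; rewrite /= in_itv.
  rewrite leNgt; apply/negP => hv0.
  have [m _ mh0] : exists2 m, True & m.+1%:R^-1 < h w v.
    have [m] := ltr_add_invr hv0; rewrite add0r => ?; by exists m.
  have [q _] := hw m I; case: asboolP => // Dq /=; apply/negP; rewrite -leNgt.
  apply: (le_trans (ltW mh0)); apply: vmin; rewrite inE => i /=.
  rewrite mxE in_itv /= -(rmorph0 (@ratr R)) -(rmorph1 (@ratr R)) !ler_rat.
  exact: Dq.
apply: bigcapT_measurable => m; apply: countable_bigcupT_measurable.
  exact: countableP.
move=> q; case: ifP => // _.
rewrite -[X in measurable X]setTI.
have -> : [set w | h w (map_mx ratr q) < m.+1%:R^-1] =
  (h^~ (map_mx ratr q)) @^-1` `]-oo, m.+1%:R^-1[%classic.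
  by rewrite preimage_itvNyo.
exact: mh.
Qed.

Lemma measurable_feasible (g : T -> 'rV[R]_n -> R) (c : R) :
  (forall v, measurable_fun setT (g^~ v)) -> (forall w, continuous (g w)) ->
  measurable [set w | exists p : 'rV[R]_n, [/\ forall i, 0 <= p 0 i,
    \sum_i p 0 i = 1, g w p <= 0 & c <= \prod_i (n%:R * p 0 i)]].
Proof.
move=> mg cg.
(* The constraints merge into one continuous penalty with three nonnegative terms, so [h w v <= 0]
   makes each term vanish. *)
pose h w (v : 'rV[R]_n) := `|\sum_i v 0 i - 1| + Num.max 0 (g w v) +
  Num.max 0 (c - \prod_i (n%:R * v 0 i)).
rewrite (_ : [set w | _] = [set w | exists2 v : 'rV[R]_n,
    (forall i, 0 <= v 0 i <= 1) & h w v <= 0]).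
  apply: measurable_exists_cube => [v|w].
    apply: measurable_funD; last exact: measurable_cst.
    apply: measurable_funD; first exact: measurable_cst.
    by apply: measurable_maxr => //; exact: measurable_cst.
  have cc (i : 'I_n) : continuous (fun v : 'rV[R]_n => v 0 i).
    exact: coord_continuous.
  have csum : continuous (fun v : 'rV[R]_n => \sum_i v 0 i).
    by apply: continuous_big => // x; exact: add_continuous.
  have cprod : continuous (fun v : 'rV[R]_n => \prod_i (n%:R * v 0 i)).
    apply: continuous_big => [x|i _ v]; first exact: mul_continuous.
    by apply: (continuous_comp (cc i v)); exact: mulrl_continuous.
  have cD (e f : 'rV[R]_n -> R) : continuous e -> continuous f ->
      continuous (fun v => e v + f v).
    by move=> ce cf v; exact: (continuousD (ce v) (cf v)).
  have cmax (f : 'rV[R]_n -> R) : continuous f ->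
      continuous (fun v => Num.max 0 (f v)).
    move=> cf v; apply: (@continuous_max _ _ (fun=> 0) f); last exact: cf.
    exact: cst_continuous.
  apply: (cD); first apply: (cD).
  - have cs1 : continuous (fun v : 'rV[R]_n => \sum_i v 0 i - 1).
      by apply: (cD) => //; exact: cst_continuous.
    by move=> v; exact: (continuous_comp (cs1 v) (@norm_continuous _ _ _)).
  - exact: cmax.
  - apply/cmax/cD; first exact: cst_continuous.
    by move=> v; exact: (continuousN (cprod v)).
apply/seteqP; split=> w /= -[p].
  move=> [p0 p1 gp cp]; exists p.
    (* Nonnegative weights of sum 1 are at most 1, so the simplex lies in the cube. *)
    by move=> i; rewrite p0 -p1 (bigD1 i) //= lerDl sumr_ge0.
  have cp' : c - \prod_i (n%:R * p 0 i) <= 0 by rewrite subr_le0.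
  by rewrite /h p1 subrr normr0 (max_idPl gp) (max_idPl cp') !addr0.
move=> p01 hp; exists p.
have : 0 <= Num.max 0 (g w p) by rewrite le_max lexx.
have : 0 <= Num.max 0 (c - \prod_i (n%:R * p 0 i)) by rewrite le_max lexx.
have := normr_ge0 (\sum_i p 0 i - 1).
move: hp; rewrite /h => hp n1 n2 n3.
have e1 : `|\sum_i p 0 i - 1| = 0 by lra.
have e2 : Num.max 0 (g w p) <= 0 by lra.
have e3 : Num.max 0 (c - \prod_i (n%:R * p 0 i)) <= 0 by lra.
split.
- by move=> i; case/andP: (p01 i).
- by apply/eqP; rewrite -subr_eq0 -normr_eq0 e1.
- by move: e2; rewrite ge_max => /andP[].
- by move: e3; rewrite ge_max subr_le0 => /andP[].
Qed.

End compact_projection.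

(** * Likelihood functionals as measurable functions of the sample *)

Section likelihood_measurability.
Context {d : measure_display} {T : measurableType d} {R : realType} {k n : nat}.
Variable x : T -> 'I_n -> 'cV[R]_k.
Hypothesis mx : forall i a, measurable_fun setT (fun w => x w i a 0).

Lemma measurable_fun_gtP (f : T -> R) :
  (forall c, measurable [set w | c < f w]) -> measurable_fun setT f.
Proof.
move=> mf mD; apply: (measurability _ (RGenOInfty.measurableE R)) => //.
by move=> _ [_ [c ->] <-]; rewrite preimage_itvoy setTI; exact: mf.
Qed.

(** For [c >= 0] the set [A c] lies between [{c < f}] and [{c <= f}], so [{c < f}] is the union of
    [A q] over rationals [q > c]. Attainment of the supremum behind [f] is thus never at issue. *)
Lemma measurable_gt_ge (A : R -> set T) (f : T -> R) :
  (forall w, 0 <= f w) ->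
  (forall c, measurable (A c)) ->
  (forall w c, A c w -> c <= f w) ->
  (forall w c, 0 <= c -> c < f w -> A c w) ->
  measurable_fun setT f.
Proof.
move=> f0 mA Af fA; apply: measurable_fun_gtP => c.
have [c0|c0] := ltP c 0.
  rewrite (_ : [set w | _] = setT) //; apply/seteqP; split=> w //= _.
  exact: lt_le_trans (f0 w).
rewrite (_ : [set w | _] = \bigcup_(q : rat)
    (if c < ratr q then A (ratr q) else set0)).
  by apply: bigcupT_measurable_rat => q; case: ifP.
apply/seteqP; split=> w /=.
  move=> /rat_in_itvoo[q]; rewrite in_itv /= => /andP[cq qf]; exists q => //.
  by rewrite cq; apply: fA => //; rewrite (le_trans c0) // ltW.
by move=> [q _]; case: ifPn => // cq /Af; exact: lt_le_trans.
Qed.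

Lemma continuous_weighted (c : 'I_n -> R) :
  continuous (fun v : 'rV[R]_n => \sum_i v 0 i * c i).
Proof.
apply: continuous_big => [v|i _ v]; first exact: add_continuous.
apply: (@continuous_comp _ _ _ (fun v : 'rV[R]_n => v 0 i) ( *%R^~ (c i))).
  exact: coord_continuous.
exact: mulrr_continuous.
Qed.

Lemma measurable_dotv (a : 'cV[R]_k) i :
  measurable_fun setT (fun w => dotv a (x w i)).
Proof.
under eq_fun do rewrite dotvE.
by apply: measurable_sum => j; apply: measurable_funM => //; exact: measurable_cst.
Qed.

Lemma measurable_EL (mu : 'cV[R]_k) : measurable_fun setT (fun w => EL (x w) mu).
Proof.
(* The vector equation for the mean is written as one inequality [g w v <= 0]. *)
pose g w (v : 'rV[R]_n) := \sum_a `|\sum_i v 0 i * (x w i - mu) a 0|.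
apply: (@measurable_gt_ge (fun c => [set w | exists p : 'rV[R]_n,
  [/\ forall i, 0 <= p 0 i,
    \sum_i p 0 i = 1, g w p <= 0 & c <= \prod_i (n%:R * p 0 i)]])).
- by move=> w; exact: EL_ge0.
- move=> c; apply: measurable_feasible => [v|w].
    apply: measurable_sum => a; apply: measurableT_comp => //.
    apply: measurable_sum => i; apply: measurable_funM => //.
    under eq_fun do rewrite !mxE.
    by apply: measurable_funB => //; exact: measurable_cst.
  apply: continuous_big => [v|a _ v]; first exact: add_continuous.
  have cw := @continuous_weighted (fun i => (x w i - mu) a 0).
  exact: (continuous_comp (cw v) (@norm_continuous _ _ _)).
- move=> w c [p [p0 p1 gp cp]]; apply: le_trans cp _; apply: EL_ge => //.
  apply/matrixP => a b; rewrite ord1 summxE mxE.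
  have /eqP : \sum_a `|\sum_i p 0 i * (x w i - mu) a 0| == 0.
    by rewrite eq_le gp sumr_ge0.
  move=> /psumr_eq0P => /(_ (fun _ _ => normr_ge0 _) a isT) /normr0_eq0 e.
  by rewrite -[RHS]e; apply: eq_bigr => i _; rewrite [LHS]mxE.
- move=> w c c0; rewrite /EL => cEL.
  (* Without admissible weights [sup] would be 0, against [0 <= c < EL]. *)
  have v0 : EL_values (x w) mu !=set0.
    by apply/set0P/eqP => E0; move: cEL; rewrite E0 sup0 ltNge c0.
  have [_ [p [p0 p1 pmu ->]] cp] := sup_gt v0 cEL.
  exists (\row_i p i); split.
  + by move=> i; rewrite mxE.
  + by under eq_bigr do rewrite mxE.
  + rewrite /g big1 // => a _; move/matrixP: pmu => /(_ a 0).
    rewrite summxE mxE => pmu; apply/normr0P/eqP; rewrite -[RHS]pmu.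
    by apply: eq_bigr => i _; rewrite [RHS]mxE; congr (_ * _); rewrite mxE.
  + by rewrite ltW //; under eq_bigr do rewrite mxE.
Qed.

(** The choice of a mean in the half-space reduces to the inequality [0 <= a . sum p_i x_i] on the
    weights, so the same compactness argument applies. *)
Lemma measurable_EL_sup_half_space (a : 'cV[R]_k) :
  measurable_fun setT (fun w => EL_sup (x w) [set mu | 0 <= dotv a mu]).
Proof.
pose g w (v : 'rV[R]_n) := - \sum_i v 0 i * dotv a (x w i).
have dotE w p : \sum_i p i * dotv a (x w i) = dotv a (\sum_i p i *: x w i).
  by rewrite dotv_sumr; apply: eq_bigr => i _; rewrite dotvZr.
apply: (@measurable_gt_ge (fun c => [set w | exists p : 'rV[R]_n,
  [/\ forall i, 0 <= p 0 i,
    \sum_i p 0 i = 1, g w p <= 0 & c <= \prod_i (n%:R * p 0 i)]])).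
- by move=> w; exact: EL_sup_ge0.
- move=> c; apply: measurable_feasible => [v|w].
    apply: measurableT_comp => //.
    apply: measurable_sum => i; apply: measurable_funM; first exact: measurable_cst.
    exact: measurable_dotv.
  move=> v.
  exact: (continuousN (@continuous_weighted (fun i => dotv a (x w i)) v)).
- move=> w c [p [p0 p1 gp cp]]; apply: le_trans cp _; apply: EL_sup_ge => //=.
  by rewrite -dotE -oppr_le0.
- move=> w c c0 /sup_gt[|_ [mu amu <-]].
    by exists (EL (x w) 0), 0 => //=; rewrite dotv0r.
  rewrite /EL => cEL.
  have v0 : EL_values (x w) mu !=set0.
    by apply/set0P/eqP => E0; move: cEL; rewrite E0 sup0 ltNge c0.
  have [_ [p [p0 p1 pmu ->]] cp] := sup_gt v0 cEL.
  exists (\row_i p i); split.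
  + by move=> i; rewrite mxE.
  + by under eq_bigr do rewrite mxE.
  + rewrite /g oppr_le0; under eq_bigr do rewrite mxE.
    by rewrite dotE; move: pmu; rewrite weighted_centered // => /subr0_eq ->.
  + by rewrite ltW //; under eq_bigr do rewrite mxE.
Qed.

End likelihood_measurability.

(** * Weak law of large numbers *)

Section pairwise_iid.
Local Open Scope ereal_scope.
Context {d d' : measure_display} {T : measurableType d} {E : measurableType d'}
  {R : realType}.
Variables (P : probability T R) (X : nat -> {RV P >-> E}).
Hypothesis indepX : forall i j A B, i != j -> measurable A -> measurable B ->
  P (X i @^-1` A `&` X j @^-1` B) = P (X i @^-1` A) * P (X j @^-1` B).
Hypothesis idX : forall i A, measurable A -> P (X i @^-1` A) = P (X 0%N @^-1` A).
Implicit Types (f g h : E -> R).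

(** Both sides are integrals of [f] against the law of the variable, and the laws agree on
    measurable sets. *)
Lemma ge0_integral_id (f : E -> \bar R) i : measurable_fun setT f ->
  (forall x, 0 <= f x) -> \int[P]_w f (X i w) = \int[P]_w f (X 0%N w).
Proof.
move=> mf f0; rewrite -[LHS](ge0_integral_distribution _ mf f0).
rewrite -[RHS](ge0_integral_distribution _ mf f0).
by apply: eq_measure_integral => A mA _; exact: idX.
Qed.

Lemma integrable_id f i : measurable_fun setT f ->
  P.-integrable setT (EFin \o (f \o X 0%N)) ->
  P.-integrable setT (EFin \o (f \o X i)).
Proof.
move=> mf /integrableP[_ foo]; apply/integrableP; split.
  by apply/measurable_EFinP; exact: measurableT_comp.
rewrite /= in foo *.
rewrite (@ge0_integral_id (fun x => `|(f x)%:E|)) //.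
by apply: measurableT_comp => //; exact/measurable_EFinP.
Qed.

Lemma integral_id f i : measurable_fun setT f ->
  P.-integrable setT (EFin \o (f \o X 0%N)) ->
  \int[P]_w (f (X i w))%:E = \int[P]_w (f (X 0%N w))%:E.
Proof.
move=> mf intf; have mf' : measurable_fun setT (EFin \o f) by exact/measurable_EFinP.
have intfi := integrable_id i mf intf.
rewrite -[LHS](integral_distribution mf' intfi).
rewrite -[RHS](integral_distribution mf' intf).
by apply: eq_measure_integral => A mA _; exact: idX.
Qed.

Section pair.
Variables (i j : nat) (ij : i != j).

Let XY w := (X i w, X j w).
Let mXY : measurable_fun setT XY.
Proof. by apply: measurable_fun_pair. Qed.
HB.instance Definition _ := isMeasurableFun.Build _ _ _ _ XY mXY.

(** The product measure is determined by its values on rectangles, given by pairwise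
    independence. *)
Let distribution_pair A : measurable A ->
  (distribution P (X i) \x distribution P (X j)) A = distribution P XY A.
Proof. by apply: product_measure_unique => B C mB mC; rewrite -indepX. Qed.

(** Tonelli for absolute values gives integrability of the product; then Fubini computes its
    integral under the product of the two laws. *)
Lemma integrable_indepM g h : measurable_fun setT g -> measurable_fun setT h ->
  P.-integrable setT (EFin \o (g \o X i)) ->
  P.-integrable setT (EFin \o (h \o X j)) ->
  P.-integrable setT (fun w => (g (X i w) * h (X j w))%:E) /\
  \int[P]_w (g (X i w) * h (X j w))%:E =
  \int[P]_w (g (X i w))%:E * \int[P]_w (h (X j w))%:E.
Proof.
move=> mg mh intg inth.
pose f (z : E * E) : \bar R := (g z.1 * h z.2)%:E.
have mf : measurable_fun setT f.
  by apply/measurable_EFinP/measurable_funM; exact: measurableT_comp.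
have maf : measurable_fun setT (abse \o f) by exact: measurableT_comp.
have mag : measurable_fun setT (fun x => `|(g x)%:E|).
  by apply: measurableT_comp => //; exact/measurable_EFinP.
have mah : measurable_fun setT (fun x => `|(h x)%:E|).
  by apply: measurableT_comp => //; exact/measurable_EFinP.
have pairE (F : E * E -> \bar R) : \int[distribution P XY]_z F z =
    \int[distribution P (X i) \x distribution P (X j)]_z F z.
  by apply: eq_measure_integral => A mA _; symmetry; exact: distribution_pair.
have absE : \int[P]_w `|f (XY w)| =
    \int[P]_w `|(g (X i w))%:E| * \int[P]_w `|(h (X j w))%:E|.
  rewrite -(ge0_integral_distribution XY maf) => [|z]; last exact: abse_ge0.
  transitivity (\int[distribution P (X i) \x distribution P (X j)]_z `|f z|).
    exact: pairE.
  rewrite fubini_tonelli1 //.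
  rewrite -(ge0_integral_distribution (X i) mag) //.
  rewrite -(ge0_integral_distribution (X j) mah) //.
  rewrite muleC -ge0_integralZl //; last first.
    by apply: integral_ge0.
  apply: eq_integral => x _; rewrite /fubini_F /= muleC -ge0_integralZl //.
  by apply: eq_integral => y _; rewrite /f /= normrM EFinM.
have intf : P.-integrable setT (f \o XY).
  apply/integrableP; split; first exact: measurableT_comp.
  rewrite absE; move/integrableP: intg => [_ goo]; move/integrableP: inth => [_ hoo].
  apply: lte_mul_pinfty => //; first by apply: integral_ge0.
  by rewrite ge0_fin_numE //; apply: integral_ge0.
split; first exact: intf.
have mg' : measurable_fun setT (EFin \o g) by exact/measurable_EFinP.
have mh' : measurable_fun setT (EFin \o h) by exact/measurable_EFinP.
have intf' : (distribution P (X i) \x distribution P (X j)).-integrable setT f.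
  apply/integrableP; split=> //.
  have <- : \int[distribution P XY]_z `|f z| =
      \int[distribution P (X i) \x distribution P (X j)]_z `|f z|.
    exact: pairE.
  rewrite (ge0_integral_distribution XY maf) => [|z]; last exact: abse_ge0.
  by move/integrableP: intf => [].
transitivity (\int[distribution P XY]_z f z).
  by rewrite (integral_distribution mf intf).
transitivity (\int[distribution P (X i) \x distribution P (X j)]_z f z).
  exact: pairE.
rewrite -integral12_prod_meas1 //.
have hfin : \int[P]_w (h (X j w))%:E \is a fin_num.
  exact: integrable_fin_num inth.
have inthj : (distribution P (X j)).-integrable setT (EFin \o h).
  exact: integrable_pushforward.
have intgi : (distribution P (X i)).-integrable setT (EFin \o g).
  exact: integrable_pushforward.
rewrite -(integral_distribution mh' inth) -(integral_distribution mg' intg).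
rewrite -(integral_distribution mh' inth) in hfin.
rewrite muleC -(fineK hfin) -integralZl //.
apply: eq_integral => x _; rewrite /fubini_F /= muleC fineK //.
by rewrite -integralZl.
Qed.

End pair.

(** Independence and mean 0 kill the cross terms, so the sum has second moment at most [n * v];
    Markov's inequality for the square concludes. *)
Lemma chebyshev_sum g (v t : R) (n : nat) : measurable_fun setT g ->
  (0 < t)%R -> P.-integrable setT (EFin \o (g \o X 0%N)) ->
  \int[P]_w (g (X 0%N w))%:E = 0 ->
  \int[P]_w (g (X 0%N w) ^+ 2)%:E <= v%:E ->
  P [set w | (t <= `|\sum_(i < n) g (X i w)|)%R] <= (n%:R * v / t ^+ 2)%:E.
Proof.
move=> mg t0 intg g0 g2v.
have mg2 : measurable_fun setT (fun x => g x ^+ 2)%R by exact: measurable_funX.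
have intg2 : P.-integrable setT (EFin \o ((fun x => g x ^+ 2)%R \o X 0%N)).
  apply/integrableP; split.
    by apply/measurable_EFinP; exact: measurableT_comp.
  apply: le_lt_trans (ltry v); apply: le_trans g2v.
  by under eq_integral do rewrite /= ger0_norm ?sqr_ge0 //.
have intgg i j : P.-integrable setT (fun w => (g (X i w) * g (X j w))%:E).
  have [<-|ij] := eqVneq i j; first exact: (integrable_id i mg2 intg2).
  by case: (integrable_indepM ij mg mg (integrable_id i mg intg)
    (integrable_id j mg intg)).
have Egg i j : i != j -> \int[P]_w (g (X i w) * g (X j w))%:E = 0.
  move=> ij; have [_ ->] := integrable_indepM ij mg mg
    (integrable_id i mg intg) (integrable_id j mg intg).
  by rewrite (integral_id _ mg intg) g0 mul0e.
pose S w := (\sum_(i < n) g (X i w))%R.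
have mS : measurable_fun setT S.
  by apply: measurable_sum => i; exact: measurableT_comp.
have S2 : \int[P]_w (S w ^+ 2)%:E <= (n%:R * v)%:E.
  have SE w : ((S w) ^+ 2)%:E =
      \sum_(i < n) \sum_(j < n) (g (X i w) * g (X j w))%:E.
    rewrite expr2 /S big_distrlr /= -sumEFin.
    by apply: eq_bigr => i _; rewrite sumEFin.
  under eq_integral do rewrite SE.
  rewrite integral_sum //=; last by move=> i; exact: integrable_sum.
  apply: (@le_trans _ _ (\sum_(i < n) v%:E)); last first.
    by rewrite sumEFin lee_fin sumr_const card_ord mulr_natl.
  apply: lee_sum => i _; rewrite integral_sum //= (bigD1 i) //=.
  rewrite big1 => [|j ji]; last by rewrite Egg // eq_sym.
  by rewrite adde0 -(integral_id i mg2 intg2) in g2v *.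
pose SS : {mfun T >-> R} := mfun_Sub (mem_set mS : S \in mfun).
have t2 : (0 < t ^+ 2)%R by rewrite exprn_gt0.
rewrite EFinM lee_pdivlMr // muleC.
have mk := @markov _ _ _ P SS (fun x => x ^+ 2)%R t t0.
apply: le_trans (mk _ _ _) _.
- exact: exprn_measurable.
- by move=> r _; exact: sqr_ge0.
- by move=> x y /= x0 y0 xy; rewrite ler_pXn2r.
apply: le_trans S2; rewrite unlock le_eqVlt; apply/orP; left; apply/eqP.
by apply: eq_integral => w _ /=; rewrite real_normK ?num_real.
Qed.

End pairwise_iid.

(** * The weak law by truncation *)

Section weak_law.
Local Open Scope ereal_scope.
Context {d d' : measure_display} {T : measurableType d} {E : measurableType d'}
  {R : realType}.
Variables (P : probability T R) (X : nat -> {RV P >-> E}).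
Hypothesis indepX : forall i j A B, i != j -> measurable A -> measurable B ->
  P (X i @^-1` A `&` X j @^-1` B) = P (X i @^-1` A) * P (X j @^-1` B).
Hypothesis idX : forall i A, measurable A -> P (X i @^-1` A) = P (X 0%N @^-1` A).
Implicit Types (f g h : E -> R).

Lemma markov_sum f (v t : R) (n : nat) : measurable_fun setT f ->
  (forall x, 0 <= f x)%R -> (0 < t)%R ->
  \int[P]_w (f (X 0%N w))%:E <= v%:E ->
  P [set w | (t <= \sum_(i < n) f (X i w))%R] <= (n%:R * v / t)%:E.
Proof.
move=> mf f0 t0 fv.
pose S w := (\sum_(i < n) f (X i w))%R.
have S0 w : (0 <= S w)%R by apply: sumr_ge0.
have mS : measurable_fun setT S.
  by apply: measurable_sum => i; exact: measurableT_comp.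
pose SS : {mfun T >-> R} := mfun_Sub (mem_set mS : S \in mfun).
have mk := @markov _ _ _ P SS id t t0.
rewrite EFinM lee_pdivlMr //.
rewrite (_ : [set w | _] = [set x | t%:E <= `|(SS x)%:E|]); last first.
  by apply/seteqP; split => w /=; rewrite lee_fin ger0_norm ?S0.
rewrite muleC; apply: le_trans (mk _ _ _) _ => //.
rewrite unlock /=.
under eq_integral do rewrite ger0_norm ?S0 // /S -sumEFin.
rewrite ge0_integral_sum //; last first.
- by move=> i w _; rewrite lee_fin.
- by move=> i; apply/measurable_EFinP; exact: measurableT_comp.
apply: (@le_trans _ _ (\sum_(i < n) v%:E)); last first.
  by rewrite sumEFin lee_fin sumr_const card_ord mulr_natl.
apply: lee_sum => i _.
by rewrite (@ge0_integral_id _ _ _ _ _ _ X idX (EFin \o f)) //; exact/measurable_EFinP.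
Qed.

Definition truncated g (c : R) x : R := if (`|g x| <= c)%R then g x else 0%R.

Lemma measurable_truncated g c : measurable_fun setT g ->
  measurable_fun setT (truncated g c).
Proof.
move=> mg; apply: measurable_fun_ifT => //.
by apply: measurable_fun_ler => //; exact: measurableT_comp.
Qed.

Lemma truncated_norm_le g c x : (0 <= c)%R -> (`|truncated g c x| <= c)%R.
Proof. by rewrite /truncated => c0; case: ifP => //; rewrite normr0. Qed.

Lemma truncated_remainder_le g c x : (`|g x - truncated g c x| <= `|g x|)%R.
Proof.
by rewrite /truncated; case: ifP => _; rewrite ?subrr ?subr0 ?normr0.
Qed.

(** Dominated convergence along integer levels: at each point the remainder is eventually 0, and it
    is dominated by [|g|]. *)
Lemma truncated_remainder_small g (e : R) : measurable_fun setT g ->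
  P.-integrable setT (EFin \o (g \o X 0%N)) -> (0 < e)%R ->
  exists2 c : R, (0 <= c)%R &
    \int[P]_w (`|g (X 0%N w) - truncated g c (X 0%N w)|)%:E <= e%:E.
Proof.
move=> mg intg e0.
pose F (n : nat) w : \bar R := (`|g (X 0%N w) - truncated g n%:R (X 0%N w)|)%:E.
have mF n : measurable_fun setT (F n).
  apply/measurable_EFinP; apply: measurableT_comp => //.
  apply: measurable_funB; first exact: measurableT_comp.
  by apply: measurableT_comp => //; exact: measurable_truncated.
have F0 w : F ^~ w @ \oo --> (cst 0 w : \bar R).
  apply: cvg_near_cst; near=> n.
  rewrite /F /truncated ifT ?subrr ?normr0 //.
  by near: n; exact: nbhs_infty_ger.
have [] := @dominated_convergence _ _ _ P setT measurableT F (cst 0)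
  (abse \o (EFin \o (g \o X 0%N))) mF (measurable_cst _) _ (integrable_abse intg) _.
- by apply: aeW => w _; exact: F0.
- by apply: aeW => w n _; rewrite /F /= lee_fin normr_id truncated_remainder_le.
move=> _ _; rewrite integral0 => /fine_cvgP[fF /cvgrPdist_lt /(_ e e0) Fe].
have [n _ nF] := (filterI fF Fe).
have [/= fn en] := nF n (leqnn _).
exists n%:R => //.
move: en; rewrite sub0r normrN /= => en.
rewrite -[leLHS](@fineK R) // lee_fin; apply: le_trans (ltW en).
exact: ler_norm.
Unshelve. all: by end_near. Qed.

(** Meant for products of two coordinates, whose variance may be infinite when only third moments
    are finite. Hence a truncation: Chebyshev for the bounded part, Markov for the remainder. *)
Lemma weak_law_large_numbers g (m e dl : R) : measurable_fun setT g ->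
  P.-integrable setT (EFin \o (g \o X 0%N)) ->
  \int[P]_w (g (X 0%N w))%:E = m%:E -> (0 < e)%R -> (0 < dl)%R ->
  \forall n \near \oo,
   P [set w | (n%:R * e <= `|\sum_(i < n) g (X i w) - n%:R * m|)%R] <= dl%:E.
Proof.
move=> mg intg gm e0 dl0.
have Pcst (a : R) : \int[P]_w a%:E = a%:E.
  by have := expectation_cst P a; rewrite unlock.
(* [e / 4] limits the shift of the mean to a quarter of the tolerance; [dl * e / 8] brings the
   Markov bound for the remainder down to [dl / 2]. *)
pose b := (Num.min (e / 4) (dl * e / 8))%R.
have b0 : (0 < b)%R by rewrite lt_min !divr_gt0 // mulr_gt0.
have [c c0 rb] := truncated_remainder_small mg intg b0.
pose gc := truncated g c; pose r x := (`|g x - gc x|)%R.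
have mgc : measurable_fun setT gc by exact: measurable_truncated.
have mr : measurable_fun setT r.
  by apply: measurableT_comp => //; exact: measurable_funB.
have intgc : P.-integrable setT (EFin \o (gc \o X 0%N)).
  apply: (le_integrable measurableT _ _ (finite_measure_integrable_cst P c measurableT)).
    by apply/measurable_EFinP; exact: measurableT_comp.
  by move=> w _ /=; rewrite lee_fin (ger0_norm c0) truncated_norm_le.
pose mc := fine (\int[P]_w (gc (X 0%N w))%:E).
have gcm : \int[P]_w (gc (X 0%N w))%:E = mc%:E.
  by rewrite fineK //; exact: integrable_fin_num intgc.
have mmc : (`|m - mc| <= b)%R.
  rewrite -lee_fin -abse_EFin EFinB -gm -gcm -integralB_EFin //.
  apply: le_trans rb; apply: le_trans (le_abse_integral _ _ _) _ => //.
  by apply: emeasurable_funB; apply/measurable_EFinP; exact: measurableT_comp.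
have mcc : (`|mc| <= c)%R.
  rewrite -lee_fin -abse_EFin -gcm.
  apply: le_trans (le_abse_integral _ _ _) _ => //.
    by apply/measurable_EFinP; exact: measurableT_comp.
  apply: (@le_trans _ _ (\int[P]_w c%:E)).
    apply: ge0_le_integral => //=.
    - by apply/measurable_EFinP; do 2 apply: measurableT_comp => //.
    - by move=> w _; rewrite lee_fin truncated_norm_le.
  by rewrite Pcst.
pose h x := (gc x - mc)%R.
have mh : measurable_fun setT h by exact: measurable_funB.
have inth : P.-integrable setT (EFin \o (h \o X 0%N)).
  have := integrableB measurableT intgc (finite_measure_integrable_cst P mc measurableT).
  by apply: eq_integrable => // w _.
have h0 : \int[P]_w (h (X 0%N w))%:E = 0.
  under eq_integral do rewrite EFinB.
  rewrite integralB_EFin //; last exact: (finite_measure_integrable_cst P mc measurableT).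
  by rewrite gcm Pcst subee.
have h2 : \int[P]_w (h (X 0%N w) ^+ 2)%:E <= (4 * c ^+ 2)%:E.
  apply: (@le_trans _ _ (\int[P]_w (4 * c ^+ 2)%:E)).
    apply: ge0_le_integral => //=.
    - by move=> w _; rewrite lee_fin sqr_ge0.
    - by apply/measurable_EFinP/measurable_funX; exact: measurableT_comp.
    move=> w _; rewrite lee_fin.
    have -> : (4 * c ^+ 2 = (2 * c) ^+ 2)%R by ring.
    rewrite -[leLHS]real_normK ?num_real // ler_pXn2r ?nnegrE //; last lra.
    apply: le_trans (ler_normB _ _) _.
    by have := truncated_norm_le g (X 0%N w) c0; rewrite -/gc; lra.
  by rewrite Pcst.
near=> n.
have n0 : (0 < n%:R :> R)%R.
  by rewrite ltr0n; near: n; exact: nbhs_infty_gt.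
have mS f : measurable_fun setT f ->
    measurable_fun setT (fun w => \sum_(i < n) f (X i w))%R.
  by move=> mf; apply: measurable_sum => i; exact: measurableT_comp.
have t0 : (0 < n%:R * e / 4)%R by rewrite divr_gt0 // mulr_gt0.
pose A := [set w | (n%:R * e / 4 <= `|\sum_(i < n) h (X i w)|)%R].
pose B := [set w | (n%:R * e / 4 <= \sum_(i < n) r (X i w))%R].
have mle (u v : T -> R) : measurable_fun setT u -> measurable_fun setT v ->
    measurable [set w | (u w <= v w)%R].
  move=> mu mv; rewrite -[X in measurable X]setTI.
  have /(_ measurableT [set true]) := measurable_fun_ler mu mv.
  by rewrite -preimage_true => /(_ I).
have mA : measurable A.
  by apply: mle => //; apply: measurableT_comp => //; exact: mS.
have mB : measurable B by apply: mle => //; exact: mS.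
apply: (@le_trans _ _ (P (A `|` B))).
  apply: le_measure; rewrite ?inE.
  - apply: mle => //; apply: measurableT_comp => //.
    by apply: measurable_funB => //; exact: mS.
  - exact: measurableU.
  move=> w /= Hw; rewrite /A /B /=; apply: contrapT => /not_orP[].
  move=> /negP; rewrite -ltNge => Aw /negP; rewrite -ltNge => Bw.
  have : (`|\sum_(i < n) g (X i w) - n%:R * m| <=
     `|\sum_(i < n) h (X i w)| + \sum_(i < n) r (X i w) + n%:R * b)%R.
    (* Three pieces: centered truncated sum, sum of remainders, shift of the mean. Outside [A] and
       [B] each is at most [n * e / 4]. *)
    have -> : (\sum_(i < n) g (X i w) - n%:R * m = \sum_(i < n) h (X i w)
        + \sum_(i < n) (g (X i w) - gc (X i w)) - n%:R * (m - mc))%R.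
      rewrite -big_split /= /h.
      under [in RHS]eq_bigr do rewrite addrC addrA subrK.
      rewrite sumrB sumr_const card_ord -[(mc *+ n)%R]mulr_natl; ring.
    apply: le_trans (ler_normB _ _) _; apply: lerD.
      apply: le_trans (ler_normD _ _) _; rewrite lerD2l; exact: ler_norm_sum.
    by rewrite normrM ger0_norm ?ler_pM2l // ltW.
  have : (n%:R * b <= n%:R * (e / 4))%R by rewrite ler_pM2l // ge_min lexx.
  have : (0 < n%:R * e)%R by rewrite mulr_gt0.
  lra.
apply: le_trans (measureU2 _ mA mB) _.
have PA := chebyshev_sum indepX idX n mh t0 inth h0 h2.
have PB := @markov_sum r b _ n mr (fun _ => normr_ge0 _) t0 rb.
apply: le_trans (leeD PA PB) _; rewrite -EFinD lee_fin.
have -> : (n%:R * b / (n%:R * e / 4) = 4 * b / e)%R.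
  by field; rewrite !gt_eqF.
have -> : (n%:R * (4 * c ^+ 2) / (n%:R * e / 4) ^+ 2 = 64 * c ^+ 2 / e ^+ 2 / n%:R)%R.
  by field; rewrite !gt_eqF.
have : (4 * b / e <= dl / 2)%R.
  rewrite ler_pdivrMr //.
  have : (b <= dl * e / 8)%R by rewrite ge_min lexx orbT.
  lra.
(* The Chebyshev term decays like [1 / n], since [c] was fixed before [n]. *)
suff : (64 * c ^+ 2 / e ^+ 2 / n%:R <= dl / 2)%R by lra.
rewrite ler_pdivrMr // -ler_pdivrMl ?divr_gt0 //.
by near: n; exact: nbhs_infty_ger.
Unshelve. all: by end_near. Qed.

End weak_law.

(** * From coordinatewise moment bounds to a well-spread sample *)

Section spread_from_moments.
Context {R : realType} {k : nat}.
Variable S : 'M[R]_k.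
Hypothesis Spd : posdefmx S.

Lemma dotv_ge0 (h : 'cV[R]_k) : 0 <= dotv h h.
Proof. by rewrite dotvE sumr_ge0 // => i _; rewrite -expr2 sqr_ge0. Qed.

Lemma normM_entries_le (h : 'cV[R]_k) i j : `|h i 0| * `|h j 0| <= dotv h h.
Proof.
have sq a : `|h a 0| ^+ 2 <= dotv h h.
  rewrite real_normK ?num_real // dotvE (bigD1 a) //= expr2 lerDl.
  by rewrite sumr_ge0 // => b _; rewrite -expr2 sqr_ge0.
have := sq i; have := sq j; have := sqr_ge0 (`|h i 0| - `|h j 0|); nra.
Qed.

Lemma bilinear_entries_le (A : 'M[R]_k) (c : R) (h : 'cV[R]_k) :
  (forall i j, `|A i j| <= c) ->
  `|\sum_i \sum_j A i j * (h i 0 * h j 0)| <= k%:R ^+ 2 * c * dotv h h.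
Proof.
move=> Ac; have -> : k%:R ^+ 2 * c * dotv h h =
    \sum_(i < k) \sum_(j < k) c * dotv h h.
  by rewrite !sumr_const card_ord; ring.
apply: le_trans (ler_norm_sum _ _ _) _; apply: ler_sum => i _.
apply: le_trans (ler_norm_sum _ _ _) _; apply: ler_sum => j _.
rewrite normrM; apply: ler_pM => //; rewrite normrM.
exact: normM_entries_le.
Qed.

(** The dual bound against the unit vectors; the constant is the trace of [invmx S]. *)
Lemma dotv_le_qform : exists2 c : R, 0 <= c &
  forall h, dotv h h <= c * qform S h.
Proof.
pose e a : 'cV[R]_k := delta_mx a 0.
exists (\sum_a qform (invmx S) (e a)).
  by apply: sumr_ge0 => a _; exact: qform_invmx_ge0.
move=> h; rewrite [in leLHS]dotvE mulr_suml; apply: ler_sum => a _.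
have -> : h a 0 = dotv h (e a).
  rewrite dotvE (bigD1 a) //= big1 => [|b ba].
    by rewrite mxE !eqxx mulr1 addr0.
  by rewrite mxE (negbTE ba) mulr0.
by rewrite -expr2 mulrC; exact: cauchy_schwarz_dual.
Qed.

Lemma qform_invmx_le_dotv : exists2 c : R, 0 <= c &
  forall h, qform (invmx S) h <= c * dotv h h.
Proof.
pose c := \sum_i \sum_j `|invmx S i j|.
have c0 : 0 <= c by apply: sumr_ge0 => i _; exact: sumr_ge0.
exists (k%:R ^+ 2 * c); first by rewrite mulr_ge0 ?sqr_ge0.
move=> h; rewrite qform_entries; apply: le_trans (ler_norm _) _.
apply: bilinear_entries_le => i j.
rewrite /c (bigD1 i) //= (bigD1 j) //= -addrA lerDl addr_ge0 // sumr_ge0 //.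
by move=> b _; exact: sumr_ge0.
Qed.

(** [C] comes first and depends on [S] and [k] only, so that [M], [c] and [L] can be chosen after
    it. The coordinatewise hypotheses are what the probabilistic inequalities deliver. *)
Lemma well_spread_of_moments : exists2 C : R, 0 < C &
  forall (n : nat) (y : 'I_n -> 'cV[R]_k) (M c L : R), (0 < n)%N -> 0 < M ->
    0 <= c -> 0 <= L -> C * L ^+ 2 <= M -> 4 * M <= c * n%:R ->
    (forall a, `|\sum_i y i a 0| <= L * Num.sqrt n%:R) ->
    (forall i, 16 * M * C * dotv (y i) (y i) <= c ^+ 2 * n%:R) ->
    (forall a b, `|\sum_i y i a 0 * y i b 0 - n%:R * S a b| <=
       n%:R * (c / (2 * C))) ->
    well_spread S y M c.
Proof.
have [c1 c10 c1P] := qform_invmx_le_dotv; have [c2 c20 c2P] := dotv_le_qform.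
have k0 : 0 <= k%:R :> R by [].
have k20 : 0 <= k%:R ^+ 2 :> R by exact: sqr_ge0.
have kc1 : 0 <= k%:R * c1 by rewrite mulr_ge0.
have kc2 : 0 <= k%:R ^+ 2 * c2 by rewrite mulr_ge0.
(* One summand per use: [c1] for single points, [k * c1] for the mean, [k^2 * c2] for the second
   moments, and 1 for positivity. *)
pose C := 1 + c1 + k%:R * c1 + k%:R ^+ 2 * c2.
have C0 : 0 < C by rewrite /C; lra.
exists C => // n y M c L n0 M0 c0 L0 CLM Mn yL yM yS; split=> //.
- move=> i; apply: le_trans (yM i).
  rewrite -[leRHS]mulrA ler_wpM2l //; first lra.
  apply: le_trans (c1P _) _; rewrite ler_wpM2r ?dotv_ge0 // /C; lra.
- have nR : 0 < n%:R :> R by rewrite ltr0n.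
  have avgE a : average y a 0 = n%:R^-1 * \sum_i y i a 0.
    by rewrite /average mxE summxE.
  have dn : n%:R * dotv (average y) (average y) <= k%:R * L ^+ 2.
    rewrite dotvE mulr_sumr.
    have -> : k%:R * L ^+ 2 = \sum_(a < k) L ^+ 2.
      by rewrite sumr_const card_ord mulr_natl.
    apply: ler_sum => a _; rewrite avgE.
    have -> : n%:R * (n%:R^-1 * (\sum_i y i a 0) * (n%:R^-1 * \sum_i y i a 0)) =
        (\sum_i y i a 0) ^+ 2 / n%:R by field; rewrite gt_eqF.
    rewrite ler_pdivrMr // -(@sqr_sqrtr _ n%:R) // -exprMn.
    rewrite -[leLHS]real_normK ?num_real // ler_pXn2r ?nnegrE //.
    by rewrite mulr_ge0 ?sqrtr_ge0.
  apply: le_trans CLM.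
  apply: (@le_trans _ _ (c1 * (n%:R * dotv (average y) (average y)))).
    by rewrite mulrCA ler_pM2l.
  apply: (@le_trans _ _ (c1 * (k%:R * L ^+ 2))); first by rewrite ler_wpM2l.
  rewrite mulrA ler_wpM2r ?sqr_ge0 // /C; lra.
- move=> h.
  have -> : \sum_i dotv h (y i) ^+ 2 - n%:R * qform S h =
      \sum_a \sum_b (\sum_i y i a 0 * y i b 0 - n%:R * S a b) * (h a 0 * h b 0).
    rewrite qform_entries mulr_sumr.
    have -> : \sum_i dotv h (y i) ^+ 2 =
        \sum_a \sum_b (\sum_i y i a 0 * y i b 0) * (h a 0 * h b 0).
      under eq_bigr do rewrite expr2 dotvE big_distrlr /=.
      rewrite exchange_big; apply: eq_bigr => a _ /=.
      rewrite exchange_big; apply: eq_bigr => b _ /=.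
      by rewrite mulr_suml; apply: eq_bigr => i _; ring.
    rewrite -sumrB; apply: eq_bigr => a _; rewrite mulr_sumr -sumrB.
    by apply: eq_bigr => b _; ring.
  pose A : 'M[R]_k := \matrix_(a, b) (\sum_i y i a 0 * y i b 0 - n%:R * S a b).
  have Ac a b : `|A a b| <= n%:R * (c / (2 * C)) by rewrite mxE.
  have := bilinear_entries_le h Ac.
  under eq_bigr do under eq_bigr do rewrite mxE.
  move=> le1; apply: le_trans le1 _.
  have qh := qform_ge0 h Spd.
  apply: (@le_trans _ _ (k%:R ^+ 2 * (n%:R * (c / (2 * C))) * (c2 * qform S h))).
    by rewrite ler_wpM2l ?c2P // !mulr_ge0 // invr_ge0; lra.
  have -> : k%:R ^+ 2 * (n%:R * (c / (2 * C))) * (c2 * qform S h) =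
    (c / 2 * (n%:R * qform S h)) * (k%:R ^+ 2 * c2 / C).
    by field; rewrite gt_eqF.
  rewrite ler_piMr //; first by rewrite !mulr_ge0 //; lra.
  by rewrite ler_pdivrMr // /C; lra.
Qed.

End spread_from_moments.

(** * Measurability of the constrained ratio *)

Section ratio_measurability.
Context {d : measure_display} {T : measurableType d} {R : realType} {k n : nat}.
Variable x : T -> 'I_n -> 'cV[R]_k.
Hypothesis mx : forall i a, measurable_fun setT (fun w => x w i a 0).

Lemma measurable_constrained_ELR (a mu : 'cV[R]_k) : measurable_fun setT
  (fun w => constrained_ELR (x w) [set nu | 0 <= dotv a nu] mu).
Proof.
have m1 := measurable_EL mx mu; have m2 := measurable_EL_sup_half_space mx a.
pose u w := EL (x w) mu; pose v w := EL_sup (x w) [set nu | 0 <= dotv a nu].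
(* The cases isolate the points where the logarithms are finite; a vanishing numerator over a
   positive denominator gives [+oo]. *)
have -> : (fun w => constrained_ELR (x w) [set nu | 0 <= dotv a nu] mu) =
    fun w => if 0 < v w then
      (if 0 < u w then (- 2 * (ln (u w) - ln (v w)))%:E else +oo%E) else 0%E.
  apply/funext => w; rewrite /constrained_ELR -/(u w) -/(v w).
  case: ltP => // v0; rewrite /m2log; case: ltP => u0.
    by rewrite lne_EFin ?divr_gt0 // ln_div.
  have uv : u w / v w <= 0 by rewrite pmulr_lle0 ?invr_gt0.
  by rewrite le0_lneNy // mulrNy ltr0_sg ?mulN1e //; lra.
apply: measurable_fun_ifT => //; first exact: measurable_fun_ltr.
apply: measurable_fun_ifT => //; first exact: measurable_fun_ltr.
apply/measurable_EFinP; apply: measurable_funM; first exact: measurable_cst.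
by apply: measurable_funB; apply: measurableT_comp.
Qed.

End ratio_measurability.

(** * Expansion in probability *)

Section borel_vectors.
Context {R : realType} {k : nat}.

(** The vectors as a measurable type with the sigma-algebra of [borel], so that random vectors
    become random variables with values in it. *)
Definition borelV := g_sigma_algebraType [set U : set 'cV[R]_k | open U].

Lemma measurable_coordV (a : 'I_k) : measurable_fun [set: borelV] (fun v => v a 0).
Proof.
apply: (measurability _ (RGenOpens.measurableE R)).
move=> _ [_ [r [s ->]] <-]; rewrite setTI; apply: sub_sigma_algebra => /=.
apply: open_comp; last exact: interval_open.
by move=> v _; exact: coord_continuous.
Qed.

Lemma measurable_enormB (mu : 'cV[R]_k) :
  measurable_fun [set: borelV] (fun v => enorm (v - mu)).
Proof.
have mY a : measurable_fun [set: borelV] (fun v => (v - mu) a 0).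
  have -> : (fun v : borelV => (v - mu) a 0) = (fun v => v a 0 - mu a 0).
    by apply/funext => v; rewrite [LHS]mxE [X in _ + X]mxE.
  by apply: measurable_funB => //; exact: measurable_coordV.
have md : measurable_fun [set: borelV] (fun v => dotv (v - mu) (v - mu)).
  have -> : (fun v : borelV => dotv (v - mu) (v - mu)) =
      (fun v => \sum_a (v - mu) a 0 * (v - mu) a 0).
    by apply/funext => v; exact: dotvE.
  by apply: measurable_sum => a; exact: measurable_funM.
apply: (measurableT_comp _ md).
by apply: continuous_measurable_fun; exact: sqrt_continuous.
Qed.

Lemma enorm_ge0 (h : 'cV[R]_k) : 0 <= enorm h.
Proof. exact: sqrtr_ge0. Qed.

Lemma sqr_enorm (h : 'cV[R]_k) : enorm h ^+ 2 = dotv h h.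
Proof. by rewrite sqr_sqrtr // dotv_ge0. Qed.

Lemma norm_entry_le (h : 'cV[R]_k) a : `|h a 0| <= enorm h.
Proof.
rewrite -(@ler_pXn2r _ 2) ?nnegrE ?enorm_ge0 // sqr_enorm expr2.
exact: normM_entries_le.
Qed.

End borel_vectors.
Arguments borelV : clear implicits.

(** * Central moments of a random vector *)

Section central_moments.
Context {d : measure_display} {T : measurableType d} {R : realType} {k : nat}.
Variables (P : probability T R) (X : {RV P >-> borelV R k}).
Variables (mu : 'cV[R]_k) (Sigma : 'M[R]_k).
Hypothesis meanX : has_mean P X mu.
Hypothesis varX : has_variance P X Sigma.
Hypothesis momentX : ('E_P[fun w => (enorm (X w - mu) ^+ 3)%R] < +oo)%E.
Local Notation Y a := (fun v : borelV R k => v a 0 - mu a 0).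

Lemma measurable_centered a : measurable_fun setT (Y a).
Proof. by apply: measurable_funB => //; exact: measurable_coordV. Qed.

(** As [t] and [t^2] are at most [1 + t^3] for [t >= 0], this one integrable function dominates
    centered coordinates and their products. *)
Let dominating w := 1 + enorm (X w - mu) ^+ 3.

Let integrable_dominating : P.-integrable setT (EFin \o dominating).
Proof.
have int1 : P.-integrable setT (EFin \o cst (1 : R)).
  exact: finite_measure_integrable_cst.
have int3 : P.-integrable setT (fun w => (enorm (X w - mu) ^+ 3)%:E).
  apply/integrableP; split.
    apply/measurable_EFinP/measurable_funX.
    exact: (measurableT_comp (measurable_enormB mu)).
  move: momentX; rewrite unlock; apply: le_lt_trans.
  by under eq_integral do rewrite /= ger0_norm ?exprn_ge0 ?enorm_ge0 //.
exact: (integrableD measurableT int1 int3).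
Qed.

Let integrable_dominated (f : T -> R) : measurable_fun setT f ->
  (forall w, `|f w| <= dominating w) -> P.-integrable setT (EFin \o f).
Proof.
move=> mf fd; apply: (le_integrable measurableT _ _ integrable_dominating).
  exact/measurable_EFinP.
move=> w _ /=; rewrite lee_fin; apply: le_trans (fd w) _; exact: ler_norm.
Qed.

Let dominating_ge w : enorm (X w - mu) <= dominating w /\
  enorm (X w - mu) ^+ 2 <= dominating w.
Proof.
rewrite /dominating; have := enorm_ge0 (X w - mu).
set t := enorm _ => t0; have [t1|t1] := leP t 1.
  have t3 : 0 <= t ^+ 3 by rewrite exprn_ge0.
  by split; [lra|have := ler_pM t0 t0 t1 t1; rewrite -expr2; lra].
have t2 : t <= t ^+ 2 by rewrite expr2 ler_peMl // ltW.
have t3 : t ^+ 2 <= t ^+ 3 by rewrite (exprS t 2) ler_peMl ?sqr_ge0 // ltW.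
by split; lra.
Qed.

Lemma integrable_centered a : P.-integrable setT (EFin \o (Y a \o X)).
Proof.
apply: integrable_dominated.
  by apply: measurableT_comp => //; exact: measurable_centered.
move=> w /=; apply: le_trans (dominating_ge w).1.
by have := norm_entry_le (X w - mu) a; rewrite !mxE.
Qed.

Lemma integral_centered a : (\int[P]_w (Y a (X w))%:E = 0)%E.
Proof.
(* Splitting the integral requires the coordinate itself to be integrable; adding the constant mean
   back provides this. *)
have intX : P.-integrable setT (EFin \o (fun w => X w a 0)).
  have := integrableD measurableT (integrable_centered a)
    (finite_measure_integrable_cst P (mu a 0) measurableT).
  by apply: eq_integrable => // w _; rewrite /= -EFinD subrK.
have := meanX a; rewrite unlock => EX.
under eq_integral do rewrite EFinB.
rewrite integralB_EFin //; last exact: (finite_measure_integrable_cst P (mu a 0) measurableT).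
rewrite EX; have := expectation_cst P (mu a 0); rewrite unlock => -> /=.
by rewrite subee.
Qed.

Lemma integrable_centeredM a b :
  P.-integrable setT (EFin \o ((fun v => Y a v * Y b v) \o X)).
Proof.
apply: integrable_dominated.
  apply: (measurableT_comp (f := fun v => Y a v * Y b v)) => //.
  by apply: measurable_funM; exact: measurable_centered.
move=> w /=; apply: le_trans (dominating_ge w).2; rewrite sqr_enorm normrM.
by have := normM_entries_le (X w - mu) a b; rewrite !mxE.
Qed.

Lemma integral_centeredM a b :
  (\int[P]_w (Y a (X w) * Y b (X w))%:E = (Sigma a b)%:E)%E.
Proof.
rewrite -varX covariance.unlock !meanX /= unlock.
by apply: eq_integral.
Qed.

End central_moments.

(** The union bound over a finite index type; measurability of [A] enters through monotonicity of
    the measure. *)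
Lemma measure_le_sum (d : measure_display) (T : measurableType d) (R : realType)
    (P : probability T R) (J : finType) (A : set T) (B : J -> set T) (e : R) :
  measurable A -> (forall j, measurable (B j)) ->
  (forall w, A w -> exists j, B j w) -> (forall j, P (B j) <= e%:E)%E ->
  (P A <= (#|J|%:R * e)%:E)%E.
Proof.
move=> mA mB AB Be; pose U s := \big[setU/set0]_(j <- s) B j.
have mU s : measurable (U s) by exact: bigsetU_measurable.
have PU s : (P (U s) <= ((size s)%:R * e)%:E)%E.
  elim: s => [|j s IH]; first by rewrite /U big_nil measure0 mul0r.
  rewrite /U big_cons; apply: le_trans (measureU2 _ (mB j) (mU s)) _.
  apply: le_trans (leeD (Be j) IH) _.
  by rewrite -EFinD lee_fin /= -natr1 mulrDl mul1r addrC.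
rewrite cardE; apply: le_trans (PU (enum J)).
apply: le_measure; rewrite ?inE // => w /AB[j Bj].
by rewrite /U -bigcup_seq; exists j => //=; rewrite mem_enum.
Qed.

Lemma cvge0P (R : realType) (u : nat -> \bar R) : (forall n, (0 <= u n)%E) ->
  (forall e : R, 0 < e -> \forall n \near \oo, (u n <= e%:E)%E) ->
  u @ \oo --> 0%E.
Proof.
move=> u0 ue; apply/fine_cvgP; split.
  near=> n; rewrite ge0_fin_numE //.
  by apply: le_lt_trans (ltry 1); near: n; exact: ue.
apply/cvgrPdist_le => e e0; near=> n.
rewrite sub0r normrN /= ger0_norm ?fine_ge0 //.
have un : (u n <= e%:E)%E by near: n; exact: ue.
rewrite -lee_fin fineK // ge0_fin_numE //; exact: le_lt_trans un (ltry e).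
Unshelve. all: by end_near. Qed.

(** * The expansion for a half-space with the true mean on its boundary *)

Section half_space_expansion.
Context {R : realType} {d : measure_display} {T : measurableType d} {k : nat}.
Variables (P : probability T R) (X : nat -> T -> 'cV[R]_k).
Variables (mu0 a : 'cV[R]_k) (Sigma : 'M[R]_k).
Hypotheses (a0 : a != 0) (amu0 : dotv a mu0 = 0).
Hypothesis hiid : iid_random_vectors P X.
Hypothesis hmean : has_mean P (X 0%N) mu0.
Hypothesis hvar : has_variance P (X 0%N) Sigma.
Hypothesis hSigma : posdefmx Sigma.
Hypothesis hmoment : ('E_P[fun w => (enorm (X 0%N w - mu0) ^+ 3)%R] < +oo)%E.

Let mX i : measurable_fun setT (X i : T -> borelV R k).
Proof. by case: hiid => mX _ _ _ B mB; rewrite setTI; exact: mX. Qed.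

Let Xr i : {RV P >-> borelV R k} := mfun_Sub (mem_set (mX i)).

(** Mutual independence for the index set [{i, j}], with [A] at [i] and [B] elsewhere. *)
Let indepX i j (A B : set (borelV R k)) : i != j ->
  measurable A -> measurable B ->
  P (Xr i @^-1` A `&` Xr j @^-1` B) = (P (Xr i @^-1` A) * P (Xr j @^-1` B))%E.
Proof.
move=> ij mA mB; case: hiid => _ + _.
move=> /(_ [fset i; j]%fset (fun l => if l == i then A else B)).
rewrite bigcap_fset /= !big_fsetU1 ?inE //= !big_seq_fset1 /= eqxx.
rewrite eq_sym (negbTE ij); apply.
by move=> l _; case: ifP.
Qed.

Let idX i (A : set (borelV R k)) : measurable A ->
  P (Xr i @^-1` A) = P (Xr 0%N @^-1` A).
Proof. by move=> mA; case: hiid => _ _; apply. Qed.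

Let Y b (v : borelV R k) : R := v b 0 - mu0 b 0.

Let mXentry i b : measurable_fun setT (fun w => X i w b 0).
Proof. exact: (measurableT_comp (measurable_coordV b) (mX i)). Qed.

Let Theta : set 'cV[R]_k := [set mu | 0 <= dotv a mu].

Let y n w (i : 'I_n) := X i w - mu0.
Arguments y : clear implicits.

Let DeltaE n w : (0 < n)%N -> Delta (fun i => X i w) mu0 n =
  Num.sqrt n%:R *: average (y n w).
Proof.
move=> n0; rewrite /Delta /sample_mean /average; congr (_ *: _).
rewrite sumrB sumr_const card_ord scalerBr -[mu0 *+ n]scaler_nat scalerA mulVf ?scale1r //.
by rewrite gt_eqF // ltr0n.
Qed.

Let Z n w : \bar R :=
  let D := Delta (fun i => X i w) mu0 n in
    (constrained_ELR (fun i : 'I_n => X i w) Theta mu0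
     - (qform (invmx Sigma) D
        - inf [set qform (invmx Sigma) (D - h) | h in Theta])%R%:E)%E.

(** Required by the union bound. The infimum over uncountably many [h] is measurable through its
    closed form for a half-space. *)
Let measurable_deviation n (e : R) : measurable [set w | (e%:E < `|Z n w|)%E].
Proof.
rewrite -[X in measurable X]setTI; apply: measurable_lte => //.
apply: measurableT_comp => //; apply: emeasurable_funB.
  exact: (measurable_constrained_ELR (x := fun w (i : 'I_n) => X i w)).
apply/measurable_EFinP.
have mD b : measurable_fun setT (fun w => Delta (fun i => X i w) mu0 n b 0).
  have -> : (fun w => Delta (fun i => X i w) mu0 n b 0) = fun w =>
      Num.sqrt n%:R * (n%:R^-1 * (\sum_(i < n) X i w b 0) - mu0 b 0).
    by apply/funext => w; rewrite /Delta /sample_mean !mxE summxE.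
  apply: measurable_funM => //; apply: measurable_funB => //.
  by apply: measurable_funM => //; exact: measurable_sum.
apply: measurable_funB.
  under eq_fun do rewrite qform_entries.
  apply: measurable_sum => b; apply: measurable_sum => c.
  by apply: measurable_funM => //; exact: measurable_funM.
under eq_fun do rewrite inf_qform_half_space //.
apply: measurable_funM => //; apply: measurable_funX; apply: measurable_minr => //.
under eq_fun do rewrite dotvE.
by apply: measurable_sum => b; exact: measurable_funM.
Qed.

(** The constants are fixed in the order [C], [dJ], [L], [M], [c], [kp], and [n] last. Outside the
    bad events [B n j] the sample is well spread and the deviation is at most [12 * c * M <= e]. *)
Theorem constrained_ELR_half_space : is_op1 P Z.
Proof.
move=> e e0; apply: cvge0P => [n|dl dl0]; first exact: measure_ge0.
have [C C0 CP] := well_spread_of_moments hSigma.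
(* Indices of the bad events: one per coordinate sum, one for the largest point, one per second
   moment. The [unit] summand keeps [J] nonempty for every [k]. *)
pose J := ('I_k + (unit + 'I_k * 'I_k))%type.
have J0 : 0 < #|{: J}|%:R :> R.
  by rewrite ltr0n; apply/card_gt0P; exists (inr (inl tt)).
pose dJ := dl / #|{: J}|%:R.
have dJ0 : 0 < dJ by rewrite divr_gt0.
have dJE : dl = #|{: J}|%:R * dJ by rewrite /dJ mulrCA divff ?mulr1 ?gt_eqF.
clearbody dJ.
pose v := 1 + \sum_b `|Sigma b b|.
have v_gt0 : 0 < v by rewrite ltr_wpDr // sumr_ge0.
have Sv b : Sigma b b <= v.
  rewrite /v (bigD1 b) //=; have := ler_norm (Sigma b b).
  have : 0 <= \sum_(i | i != b) `|Sigma i i| by rewrite sumr_ge0.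
  lra.
clearbody v.
(* With this [L] the Chebyshev bound [n v / (L sqrt n)^2] is exactly [dJ]. *)
pose L := Num.sqrt (v / dJ).
have L2 : L ^+ 2 = v / dJ by rewrite sqr_sqrtr // divr_ge0 // ltW.
have L0 : 0 < L by rewrite sqrtr_gt0 divr_gt0.
clearbody L.
have [M M0 CLM] : exists2 M : R, 0 < M & C * L ^+ 2 <= M.
  by exists (C * L ^+ 2) => //; rewrite mulr_gt0 // exprn_gt0.
pose c := Num.min (1 / 4) (e / (12 * M)).
have c0 : 0 < c by rewrite lt_min !divr_gt0 ?mulr_gt0 //.
have c14 : 0 < c <= 1 / 4 by rewrite c0 ge_min lexx.
have ce : 12 * c * M <= e.
  have : c <= e / (12 * M) by rewrite ge_min lexx orbT.
  by rewrite ler_pdivlMr ?mulr_gt0 //; lra.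
clearbody c.
(* Chosen so that [|y_i|^2 <= kp * n] is exactly the condition on single points. *)
pose kp := c ^+ 2 / (16 * M * C).
have kp0 : 0 < kp by rewrite divr_gt0 ?exprn_gt0 // !mulr_gt0.
have kpE : c ^+ 2 = 16 * M * C * kp by rewrite /kp; field; rewrite !gt_eqF.
clearbody kp.
pose cube (x : borelV R k) : R := enorm (x - mu0) ^+ 3.
have mcube : measurable_fun setT cube.
  by apply: measurable_funX; exact: measurable_enormB.
have mY b : measurable_fun setT (Y b) := measurable_centered mu0 b.
have mYY b b' : measurable_fun setT (fun x => Y b x * Y b' x).
  exact: measurable_funM.
have cubef : (\int[P]_w (cube (X 0%N w))%:E)%E \is a fin_num.
  rewrite ge0_fin_numE; first by move: hmoment; rewrite unlock.
  by apply: integral_ge0 => w _; rewrite lee_fin exprn_ge0 ?enorm_ge0.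
pose v3 := fine (\int[P]_w (cube (X 0%N w))%:E)%E.
have cv3 : (\int[P]_w (cube (Xr 0%N w))%:E <= v3%:E)%E by rewrite /v3 fineK.
clearbody v3.
(* The largest point is controlled through the sum of cubed norms, which is at least the cube of any
   one of them. *)
pose B n (j : J) : set T := match j with
  | inl b => [set w | L * Num.sqrt n%:R <= `|\sum_(i < n) Y b (Xr i w)|]
  | inr (inl _) => [set w | Num.sqrt (kp * n%:R) ^+ 3 <=
                       \sum_(i < n) cube (Xr i w)]
  | inr (inr (b, b')) => [set w | n%:R * (c / (2 * C)) <=
      `|\sum_(i < n) Y b (Xr i w) * Y b' (Xr i w) - n%:R * Sigma b b'|]
  end.
have mle (f g : T -> R) : measurable_fun setT f -> measurable_fun setT g ->
    measurable [set w | (f w <= g w)%R].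
  move=> mf mg; rewrite -[X in measurable X]setTI.
  have /(_ measurableT [set true]) := measurable_fun_ler mf mg.
  by rewrite -preimage_true => /(_ I).
have mS n (f : borelV R k -> R) : measurable_fun [set: borelV R k] f ->
    measurable_fun setT (fun w => \sum_(i < n) f (Xr i w)).
  by move=> mf; apply: measurable_sum => i; exact: measurableT_comp.
have mB n j : measurable (B n j).
  case: j => [b|[_|[b b']]] /=; apply: mle => //.
  - by apply: measurableT_comp => //; exact: mS.
  - exact: mS.
  - apply: measurableT_comp => //; apply: measurable_funB => //.
    exact: (mS n (fun x => Y b x * Y b' x)).
have PB : \forall n \near \oo, forall j, (P (B n j) <= dJ%:E)%E.
  apply: filter_forall => -[b|[u|[b b']]].
  - near=> n.
    have n0 : 0 < n%:R :> R by rewrite ltr0n; near: n; exact: nbhs_infty_gt.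
    have t0 : 0 < L * Num.sqrt n%:R by rewrite mulr_gt0 // sqrtr_gt0.
    have Y2 : (\int[P]_w (Y b (Xr 0%N w) ^+ 2)%:E <= v%:E)%E.
      have := integral_centeredM (X := Xr 0%N) hmean hvar b b.
      by rewrite /Y; under eq_integral do rewrite -expr2; move=> ->; rewrite lee_fin.
    have Y1 : P.-integrable setT (EFin \o (Y b \o Xr 0%N)).
      exact: (integrable_centered (X := Xr 0%N) hmoment b).
    have Y0 : (\int[P]_w (Y b (Xr 0%N w))%:E = 0)%E.
      exact: (integral_centered (X := Xr 0%N) hmean hmoment b).
    have ch := chebyshev_sum indepX idX n (mY b) t0 Y1 Y0 Y2.
    apply: (le_trans ch).
    rewrite lee_fin exprMn sqr_sqrtr ?ler0n // L2.
    rewrite (_ : _ / _ = dJ) //.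
    by field; rewrite !gt_eqF.
  - near=> n.
    have n0 : 0 < n%:R :> R by rewrite ltr0n; near: n; exact: nbhs_infty_gt.
    have kn0 : 0 < kp * n%:R by rewrite mulr_gt0.
    have t0 : 0 < Num.sqrt (kp * n%:R) ^+ 3 by rewrite exprn_gt0 // sqrtr_gt0.
    have cube0 x : 0 <= cube x by rewrite exprn_ge0 ?enorm_ge0.
    apply: (le_trans (markov_sum idX n mcube cube0 t0 cv3)).
    (* The Markov bound [n v3 / (kp n)^(3/2)] is at most [dJ] once [sqrt (kp n)] reaches
       [v3 / (kp dJ)]. *)
    have hs : v3 / (kp * dJ) <= Num.sqrt (kp * n%:R).
      apply: le_trans (ler_norm _) _; rewrite -sqrtr_sqr ler_sqrt ?(ltW kn0) //.
      by rewrite -ler_pdivrMl //; near: n; exact: nbhs_infty_ger.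
    rewrite lee_fin ler_pdivrMr // (exprS _ 2) sqr_sqrtr ?(ltW kn0) //.
    move: hs; rewrite ler_pdivrMr ?mulr_gt0 // => /(ler_wpM2l (ltW n0)); lra.
  - have cc0 : 0 < c / (2 * C) by rewrite divr_gt0 // mulr_gt0.
    have YY1 := integrable_centeredM (X := Xr 0%N) hmoment b b'.
    have YYS := integral_centeredM (X := Xr 0%N) hmean hvar b b'.
    exact: (weak_law_large_numbers indepX idX (mYY b b') YY1 YYS cc0 dJ0).
near=> n.
have n0 : (0 < n)%N by near: n; exact: nbhs_infty_gt.
have nR : 0 < n%:R :> R by rewrite ltr0n.
rewrite dJE; apply: (measure_le_sum (B := B n)) => //; last by near: n.
(* By contraposition: if [w] avoids every bad event, the deterministic expansion applies to its
   sample. *)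
move=> w /= Zw; apply: contrapT => /forallNP NB.
move: Zw; apply/negP; rewrite -leNgt; apply: le_trans (_ : _ <= e%:E)%E => //.
apply: (le_trans (y := (12 * c * M)%:E)); last by rewrite lee_fin.
apply: constrained_ELR_approx => //; last exact: DeltaE.
apply: (CP n _ M c L) => //.
- exact: ltW.
- exact: ltW.
- rewrite -ler_pdivrMl //; near: n; exact: nbhs_infty_ger.
- move=> b; rewrite (eq_bigr (fun i : 'I_n => Y b (Xr i w))) => [|i _].
    by have /negP := NB (inl b); rewrite -ltNge => /ltW.
  by rewrite !mxE.
- move=> i; have /negP := NB (inr (inl tt)); rewrite -ltNge => cl.
  have kn : 0 <= kp * n%:R by rewrite mulr_ge0 // ltW.
  have ys : enorm (X i w - mu0) <= Num.sqrt (kp * n%:R).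
    rewrite -(@ler_pXn2r _ 3) ?nnegrE ?enorm_ge0 ?sqrtr_ge0 //.
    apply: le_trans (ltW cl); rewrite (bigD1 i) //= lerDl.
    by apply: sumr_ge0 => j _; rewrite exprn_ge0 ?enorm_ge0.
  have -> : c ^+ 2 * n%:R = 16 * M * C * Num.sqrt (kp * n%:R) ^+ 2.
    by rewrite sqr_sqrtr // kpE; ring.
  rewrite ler_pM2l ?mulr_gt0 // -sqr_enorm.
  by rewrite ler_pXn2r ?nnegrE ?enorm_ge0 ?sqrtr_ge0.
- move=> b b'; rewrite (eq_bigr (fun i : 'I_n => Y b (Xr i w) * Y b' (Xr i w))).
    by have /negP := NB (inr (inr (b, b'))); rewrite -ltNge => /ltW.
  by move=> i _; rewrite !mxE.
Unshelve. all: by end_near. Qed.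

End half_space_expansion.

(** The point [(m, m)] is orthogonal to [a], hence on the boundary of [Theta]; [Theta] and [K] are
    the same half-space, and the general expansion is taken at [k = 2]. *)
Theorem lemma2p5 (R : realType) (d : measure_display) (T : measurableType d)
  (P : probability T R) (X : nat -> T -> 'cV[R]_2) (m : R) (mu0 : 'cV[R]_2)
  (Sigma : 'M[R]_2) (Theta K : set 'cV[R]_2)
  (hTheta : Theta = [set mu | 0 <= dotv (a_vec R) mu])
  (hK : K = [set h | 0 <= dotv (a_vec R) h])
  (hmu0 : mu0 = \col_(i < 2) m)
  (hiid : iid_random_vectors P X)
  (hmean : forall i, has_mean P (X i) mu0)
  (hvar : forall i, has_variance P (X i) Sigma)
  (hSigma : posdefmx Sigma)
  (hmoment : forall i, ('E_P[fun w => (enorm (X i w - mu0) ^+ 3)%R] < +oo)%E)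
  (hhull : forall M : R,
    P [set w | [set mu0 + (Num.sqrt n%:R)^-1 *: h
                 | h in [set h : 'cV[R]_2 | enorm h <= M]] `<=`
               (convex_hull (range (fun i : 'I_n => X i w)))°]
      @[n --> \oo] --> 1%E) :
  is_op1 P (fun n w =>
    let D := Delta (fun i => X i w) mu0 n in
    (constrained_ELR (fun i : 'I_n => X i w) Theta mu0
     - (qform (invmx Sigma) D
        - inf [set qform (invmx Sigma) (D - h) | h in K])%R%:E)%E).
Proof.
rewrite hTheta hK; apply: constrained_ELR_half_space => //.
- by apply/eqP => /matrixP /(_ 1 0); rewrite !mxE => /eqP; rewrite oner_eq0.
- by rewrite hmu0 dotvE 2!big_ord_recl big_ord0 !mxE /=; ring.
Qed.
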